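(* Let $s\in\mathbb R$ and $p,q\in(0,+\infty]$. If the wavelet system $\{\psi^{(i)}_{j,k}\}$ satisfies the dyadic covering property, then the set of sequences of $b^{s,q}_p$ whose wavelet series is maximally divergent in $\mathbb R^d$ is maximal lineable in $b^{s,q}_p$: its union with $\{0\}$ contains a vector subspace of $b^{s,q}_p$ whose (Hamel) dimension equals that of $b^{s,q}_p$.
   Context: Setting: integers $d,N\ge1$, bounded fast-decaying $\psi^{(1)},\dots,\psi^{(N)}:\mathbb R^d\to\mathbb C$, wavelets $\psi^{(i)}_{j,k}(x)=\psi^{(i)}(2^jx-k)$, $j\ge0$, $k\in\mathbb Z^d$; dyadic cubes $\lambda_{j,k}=\prod_{m=1}^d[k_m2^{-j},(k_m+1)2^{-j})$ of scale $j$; coefficients indexed by $(i,\lambda)$; $\Lambda_j$ = pairs $(i,\lambda)$ with $\lambda$ of scale $j$. $b^{s,q}_p$: sequences $(c^{(i)}_\lambda)$ with $\big(\big(\sum_{(i,\lambda)\in\Lambda_j}|c^{(i)}_\lambda2^{(s-d/p)j}|^p\big)^{1/p}\big)_{j\ge0}\in\ell^q$ (supremum if $p=\infty$). Divergence exponent $\delta_{\mathcal C}(x)$: supremum of $\gamma$ such that there exist $C>0$ and $(i_n,j_n,k_n)$ with $j_n\to\infty$ and $|c^{(i_n)}_{j_n,k_n}\psi^{(i_n)}_{j_n,k_n}(x)|\ge C2^{\gamma j_n}$. Maximal divergence in a nonempty open $A$: (i) $\delta_{\mathcal C}(x)\in[-s,d/p-s]$ for all $x\in A$; (ii) $\delta_{\mathcal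 C}=-s$ a.e. on $A$; (iii) for every nonempty open $B\subset A$ and $\gamma\in[-s,d/p-s]$, $\dim_H\{x\in B:\delta_{\mathcal C}(x)=\gamma\}=d-sp-\gamma p$ (for $p=\infty$: $\delta_{\mathcal C}=-s$ on $A$). Dyadic covering property: there exist $C_0>0$ and finitely many triplets $(i_l,j_l,k_l)$ with $j_l\ge1$ such that every $x\in[0,1)^d$ has some $l$ with $|\psi^{(i_l)}(2^{j_l}x-k_l)|\ge C_0$. *)

(* Defs.v *)
From Stdlib Require Import Reals ZArith List.
From Stdlib Require Fin.
Open Scope R_scope.

Record Cx := mkC { Cre : R; Cim : R }.
Definition C0 : Cx := mkC 0 0.
Definition Cadd (a b : Cx) : Cx := mkC (Cre a + Cre b) (Cim a + Cim b).
Definition Cmul (a b : Cx) : Cx :=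
  mkC (Cre a * Cre b - Cim a * Cim b) (Cre a * Cim b + Cim a * Cre b).
Definition Cmod (a : Cx) : R := sqrt (Cre a * Cre a + Cim a * Cim a).

(** Real power x^y for x >= 0 (with 0^y := 0, used for y > 0). *)
Definition rpow (x y : R) : R := if Rlt_dec 0 x then Rpower x y else 0.

Definition Rd (d : nat) := Fin.t d -> R.
Definition Zd (d : nat) := Fin.t d -> Z.

(** Extended exponent in (0, +oo]: [Some r] = r, [None] = +oo. *)
Definition ext_pos (p : option R) : Prop :=
  match p with Some r => 0 < r | None => True end.
Definition d_over (d : nat) (p : option R) : R :=
  match p with Some r => INR d / r | None => 0 end.

(** Wavelet coefficient sequences c^{(i)}_{j,k}, indexed by (i, lambda_{j,k}). *)
Definition cseq (N d : nat) := Fin.t N -> nat -> Zd d -> Cx.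

Definition lsum {I : Type} (f : I -> R) (l : list I) : R :=
  fold_right (fun a acc => f a + acc) 0 l.

(** [layer_norm c p s j A]: A = ( sum_{(i,lambda) in Lambda_j} |c 2^{(s-d/p)j}|^p )^{1/p}
    (supremum if p = oo), and this quantity is finite. *)
Definition layer_norm {N d : nat} (c : cseq N d) (p : option R) (s : R) (j : nat)
  (A : R) : Prop :=
  match p with
  | Some r =>
      exists u,
        is_lub (fun t => exists l : list (Fin.t N * Zd d), NoDup l /\
                  t = lsum (fun ik => rpow (Cmod (c (fst ik) j (snd ik)) *
                                     Rpower 2 ((s - INR d / r) * INR j)) r) l) u
        /\ A = rpow u (/ r)
  | None =>
      is_lub (fun t => exists i k, t = Cmod (c i j k) * Rpower 2 (s * INR j)) A
  end.

Definition in_lq (A : nat -> R) (q : option R) : Prop :=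
  match q with
  | Some r => exists M, forall n, sum_f_R0 (fun j => rpow (A j) r) n <= M
  | None => exists M, forall j, A j <= M
  end.

Definition in_besov {N d : nat} (s : R) (p q : option R) (c : cseq N d) : Prop :=
  exists A : nat -> R, (forall j, layer_norm c p s j (A j)) /\ in_lq A q.

Definition dil {d : nat} (j : nat) (k : Zd d) (x : Rd d) : Rd d :=
  fun m => 2 ^ j * x m - IZR (k m).

Definition div_set {N d : nat} (psi : Fin.t N -> Rd d -> Cx) (c : cseq N d)
  (x : Rd d) (g : R) : Prop :=
  exists C, 0 < C /\
  exists (i_ : nat -> Fin.t N) (j_ : nat -> nat) (k_ : nat -> Zd d),
    (forall M, exists n0, forall n, (n0 <= n)%nat -> (M <= j_ n)%nat) /\
    forall n, Cmod (c (i_ n) (j_ n) (k_ n)) * Cmod (psi (i_ n) (dil (j_ n) (k_ n) x))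
              >= C * Rpower 2 (g * INR (j_ n)).

Definition div_exp_is {N d : nat} (psi : Fin.t N -> Rd d -> Cx) (c : cseq N d)
  (x : Rd d) (v : R) : Prop := is_lub (div_set psi c x) v.

(** Open sets of R^d (sup-norm balls; same topology as Euclidean). *)
Definition is_open {d : nat} (A : Rd d -> Prop) : Prop :=
  forall x, A x -> exists r, 0 < r /\
    forall y, (forall m, Rabs (y m - x m) < r) -> A y.

Definition leb_null {d : nat} (E : Rd d -> Prop) : Prop :=
  forall eps, 0 < eps ->
  exists (a : nat -> Rd d) (r : nat -> R),
    (forall n, 0 <= r n) /\
    (forall x, E x -> exists n, forall m, Rabs (x m - a n m) <= r n) /\
    (forall n, sum_f_R0 (fun k => (2 * r k) ^ d) n <= eps).

(** H^t(E) = 0, i.e. H^t_delta(E) = 0 for every delta > 0 (diameters w.r.t. the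
    sup-norm, bi-Lipschitz equivalent to the Euclidean one). *)
Definition haus_null {d : nat} (t : R) (E : Rd d -> Prop) : Prop :=
  forall delta, 0 < delta -> forall eps, 0 < eps ->
  exists (F : nat -> Rd d -> Prop) (r : nat -> R),
    (forall n, 0 <= r n <= delta /\
       forall x y, F n x -> F n y -> forall m, Rabs (x m - y m) <= r n) /\
    (forall x, E x -> exists n, F n x) /\
    (forall n, sum_f_R0 (fun k => rpow (r k) t) n <= eps).

(** dim_H E = v  (with the convention dim_H(emptyset) = -oo, so E must be
    nonempty):  v = inf { t > 0 : H^t(E) = 0 }. *)
Definition hdim_is {d : nat} (E : Rd d -> Prop) (v : R) : Prop :=
  (exists x, E x) /\
  (forall t, 0 < t -> haus_null t E -> v <= t) /\
  (forall w, (forall t, 0 < t -> haus_null t E -> w <= t) -> w <= v).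

Definition max_divergent {N d : nat} (psi : Fin.t N -> Rd d -> Cx) (s : R)
  (p : option R) (c : cseq N d) (A : Rd d -> Prop) : Prop :=
  match p with
  | None => forall x, A x -> div_exp_is psi c x (- s)
  | Some r =>
      (forall x, A x -> exists v, div_exp_is psi c x v /\ - s <= v <= INR d / r - s) /\
      leb_null (fun x => A x /\ ~ div_exp_is psi c x (- s)) /\
      (forall B : Rd d -> Prop, is_open B -> (exists x, B x) ->
         (forall x, B x -> A x) ->
         forall g, - s <= g <= INR d / r - s ->
           hdim_is (fun x => B x /\ div_exp_is psi c x g) (INR d - s * r - g * r))
  end.

Definition szero {N d : nat} : cseq N d := fun _ _ _ => C0.
Definition sadd {N d : nat} (a b : cseq N d) : cseq N d :=
  fun i j k => Cadd (a i j k) (b i j k).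
Definition sscal {N d : nat} (z : Cx) (a : cseq N d) : cseq N d :=
  fun i j k => Cmul z (a i j k).
Definition lincomb {N d : nat} {I : Type} (l : list I) (a : I -> Cx)
  (e : I -> cseq N d) : cseq N d :=
  fold_right (fun t acc => sadd (sscal (a t) (e t)) acc) szero l.

Definition subspace {N d : nat} (V : cseq N d -> Prop) : Prop :=
  V szero /\ (forall u v, V u -> V v -> V (sadd u v)) /\
  (forall z u, V u -> V (sscal z u)).

Definition hamel_basis {N d : nat} {I : Type} (W : cseq N d -> Prop)
  (e : I -> cseq N d) : Prop :=
  (forall t, W (e t)) /\
  (forall (l : list I) (a : I -> Cx), NoDup l -> lincomb l a e = szero ->
     forall t, In t l -> a t = C0) /\
  (forall w, W w -> exists (l : list I) (a : I -> Cx), w = lincomb l a e).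

Definition bijective {A B : Type} (g : A -> B) : Prop :=
  (forall x y, g x = g y -> x = y) /\ (forall y, exists x, g x = y).

Definition same_dim {N d : nat} (W1 W2 : cseq N d -> Prop) : Prop :=
  exists (I J : Type) (e : I -> cseq N d) (f : J -> cseq N d) (g : I -> J),
    hamel_basis W1 e /\ hamel_basis W2 f /\ bijective g.

Definition maximal_lineable {N d : nat} (M X : cseq N d -> Prop) : Prop :=
  exists V : cseq N d -> Prop, subspace V /\ (forall c, V c -> X c) /\
    (forall c, V c -> M c \/ c = szero) /\ same_dim V X.

Definition bounded_fn {d : nat} (f : Rd d -> Cx) : Prop :=
  exists C, forall x, Cmod (f x) <= C.
Definition fast_decay {d : nat} (f : Rd d -> Cx) : Prop :=
  forall m : nat, exists C, forall x i, Cmod (f x) * (1 + Rabs (x i)) ^ m <= C.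

Definition dyadic_covering {N d : nat} (psi : Fin.t N -> Rd d -> Cx) : Prop :=
  exists C0 : R, 0 < C0 /\
  exists l : list (Fin.t N * nat * Zd d),
    (forall t, In t l -> (1 <= snd (fst t))%nat) /\
    forall x : Rd d, (forall m, 0 <= x m < 1) ->
      exists t, In t l /\
        Cmod (psi (fst (fst t)) (dil (snd (fst t)) (snd t) x)) >= C0.

(* Main.v *)
Require Import Defs.
From Stdlib Require Import Reals ZArith List.
From Stdlib Require Fin.
From Stdlib Require Import Lia Lra Psatz Ring ClassicalEpsilon FunctionalExtensionality.
From Stdlib Require Cantor Wf_nat FinFun.
From mathcomp Require classical_sets.
Open Scope R_scope.
Set Bullet Behavior "Strict Subproofs".

(** A single explicit sequence [B] saturates the Besov condition on every layer [j]: up to a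
    polynomial factor in [j], its coefficient at [k] is [2^((d/p - s) j - (d/p) a)], where [a] is
    the lowest scale at which [k 2^(-j)] is a dyadic point (up to a bounded error, which lets the
    dyadic covering property apply). Every point then has exponent at least [-s], and a point
    that is within [2^(-J)] of a dyadic point of scale [theta J] for infinitely many [J] has exponent
    at least [(d/p) (1 - theta) - s]. Restricting [B] to infinitely many layers preserves this.

    The linear map [transplant] sends [u] to the sequence that repeats every coefficient of [u],
    normalised and multiplied by [B], on infinitely many blocks of layers. It is injective, and every
    nonzero [u] of the Besov space has a maximally divergent image. Hence the image of a Hamel basis
    of the whole space spans the required subspace, and no cardinality has to be computed.

    For any Besov sequence, fast decay and a count of the large coefficients bound the dimension of
    [{delta >= gamma}] by [d - s p - gamma p]. For the converse inequality, take a Cantor set of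
    dimension [d theta] of points whose binary digits vanish on runs [theta J, J] along a rapidly
    growing sequence of scales [J]; the points where the exponent is too large lie in a countable
    union of sets of smaller dimension, which cannot cover the Cantor set together with a set of
    dimension less than [d theta]. *)

(** The obstacle is cancellation in linear combinations. On one block of layers every image under
    [transplant] is a scalar multiple of the same sequence [B], hence so is every combination of
    images; a nonzero scalar on one block comes back on infinitely many blocks, which is all that
    divergence asks. Normalising the coefficients of scale [j] by [2^(-(d/p - s) j)] makes these
    scalars bounded for each Besov sequence. The image is then at most a constant times [B], and so
    it lies in the space for all [p] and [q], including those below 1.

    The polynomial factor has exponent [(d + 1)/p + 2/q]: [d/p] pays for the positions in a window
    whose size grows like [j], [1/p] for the [j + 1] dyadic scales seen in layer [j], and [2/q] for
    summability over the layers.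

    The lower bound on dimensions is the mass distribution principle in combinatorial form: the
    cubes of the Cantor construction have masses, a cover becomes a list of cubes, and one descends
    into a subcube whose listed mass stays strictly below its own mass. *)

Lemma choice {A B : Type} (P : A -> B -> Prop) :
  (forall x, exists y, P x y) -> exists f, forall x, P x (f x).
Proof.
  intros H. exists (fun x => proj1_sig (constructive_indefinite_description _ (H x))).
  intros x. apply proj2_sig.
Qed.

(** * Powers of two, real powers and the complex modulus *)

Lemma Rabs_le_inv (x y : R) : Rabs x <= y -> - y <= x <= y.
Proof. unfold Rabs; destruct (Rcase_abs x); lra. Qed.

Lemma pow2_pos (x : R) : 0 < Rpower 2 x.
Proof. apply exp_pos. Qed.

Lemma pow2_le (x y : R) : x <= y -> Rpower 2 x <= Rpower 2 y.
Proof. intros; apply Rle_Rpower; lra. Qed.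

Lemma pow2_INR (n : nat) : Rpower 2 (INR n) = 2 ^ n.
Proof. apply Rpower_pow; lra. Qed.

Lemma pow2_plus (x y : R) : Rpower 2 (x + y) = Rpower 2 x * Rpower 2 y.
Proof. apply Rpower_plus. Qed.

Lemma pow2_0 : Rpower 2 0 = 1.
Proof. apply Rpower_O; lra. Qed.

Lemma pow2_opp_mult (x : R) : Rpower 2 x * Rpower 2 (- x) = 1.
Proof. rewrite <- pow2_plus, Rplus_opp_r; apply pow2_0. Qed.

Lemma pow2_ge_1 (n : nat) : 1 <= 2 ^ n.
Proof. apply pow_R1_Rle; lra. Qed.

Lemma exists_nat_ge (x : R) : exists n : nat, x <= INR n.
Proof.
  destruct (INR_unbounded x) as [n Hn]. exists n; lra.
Qed.

Lemma ln2_pos : 0 < ln 2.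
Proof. pose proof ln_lt_2; lra. Qed.

Lemma pow2_surj (x : R) : 0 < x -> exists y, Rpower 2 y = x.
Proof.
  intros hx. exists (ln x / ln 2). unfold Rpower.
  replace (ln x / ln 2 * ln 2) with (ln x). apply exp_ln; auto.
  field. pose proof ln2_pos; lra.
Qed.

Lemma pow2_small (a eps : R) : 0 < a -> 0 < eps ->
  exists n0 : nat, forall n, (n0 <= n)%nat -> Rpower 2 (- a * INR n) <= eps.
Proof.
  intros ha he. destruct (pow2_surj eps he) as [y <-].
  destruct (exists_nat_ge (- y / a)) as [n0 Hn0].
  exists n0. intros n Hn. apply pow2_le. apply le_INR in Hn.
  assert (- y / a <= INR n) by lra.
  apply (Rmult_le_compat_l a) in H; [|lra].
  replace (a * (- y / a)) with (- y) in H by (field; lra). lra.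
Qed.

(** The inequality [1 + x <= exp x] puts [ln (1 + n)] below a line of any slope [dl > 0]. Here [dl]
    is chosen with [m * dl <= eps * ln 2], and the division by [m + 1] covers [m = 0]. *)
Lemma pow_absorbed_by_exp (m eps : R) : 0 <= m -> 0 < eps ->
  exists c, 0 < c /\ forall n : nat,
    c * Rpower 2 (- eps * INR n) <= Rpower (1 + INR n) (- m).
Proof.
  intros hm he.
  set (dl := eps * ln 2 / (m + 1)).
  assert (hl := ln2_pos).
  assert (hdl : 0 < dl). { unfold dl. apply Rdiv_lt_0_compat; nra. }
  exists (exp (- m * (dl - ln dl))). split; [apply exp_pos|]. intros n.
  unfold Rpower. rewrite <- exp_plus.
  assert (hn := pos_INR n).
  assert (H : ln (1 + INR n) <= dl * (1 + INR n) - ln dl).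
  { assert (0 < dl * (1 + INR n)) by nra.
    assert (H1 := exp_ineq1_le (ln (dl * (1 + INR n)))).
    rewrite exp_ln in H1 by auto. rewrite ln_mult in H1 by lra. lra. }
  assert (H2 : m * dl <= eps * ln 2).
  { unfold dl. replace (m * (eps * ln 2 / (m + 1))) with (eps * ln 2 * (m / (m + 1))) by (field; lra).
    assert (m / (m + 1) <= 1). { apply Rmult_le_reg_r with (m + 1); [lra|]. field_simplify; lra. }
    assert (0 < eps * ln 2) by nra. nra. }
  assert (H3 : - m * (dl - ln dl) + - eps * INR n * ln 2 <= - m * ln (1 + INR n)).
  { assert (m * ln (1 + INR n) <= m * (dl * (1 + INR n) - ln dl)) by (apply Rmult_le_compat_l; lra).
    assert (m * dl * INR n <= eps * ln 2 * INR n) by (apply Rmult_le_compat_r; lra). nra. }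
  destruct H3 as [H3|H3]; [left; apply exp_increasing; auto | right; f_equal; auto].
Qed.

Lemma rpow_pos (x y : R) : 0 < x -> rpow x y = Rpower x y.
Proof. intros; unfold rpow; destruct (Rlt_dec 0 x); auto; lra. Qed.

Lemma rpow_0 (y : R) : rpow 0 y = 0.
Proof. unfold rpow; destruct (Rlt_dec 0 0); auto; lra. Qed.

Lemma rpow_nonneg (x y : R) : 0 <= rpow x y.
Proof. unfold rpow; destruct (Rlt_dec 0 x); [left; apply exp_pos | lra]. Qed.

Lemma rpow_gt_0 (x y : R) : 0 < x -> 0 < rpow x y.
Proof. intros; rewrite rpow_pos by auto; apply exp_pos. Qed.

Lemma rpow_le (x y z : R) : 0 <= x <= y -> 0 < z -> rpow x z <= rpow y z.
Proof.
  intros H hz. destruct (Rle_lt_or_eq_dec 0 x) as [h|h]; [lra| |].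
  - rewrite !rpow_pos by lra. apply Rle_Rpower_l; lra.
  - subst x. rewrite rpow_0. apply rpow_nonneg.
Qed.

Lemma rpow_mult (x y z : R) : 0 <= x -> 0 <= y -> rpow (x * y) z = rpow x z * rpow y z.
Proof.
  intros hx hy. destruct (Rle_lt_or_eq_dec 0 x hx) as [h|h].
  - destruct (Rle_lt_or_eq_dec 0 y hy) as [h'|h'].
    + rewrite !rpow_pos by nra. symmetry; apply Rpower_mult_distr; auto.
    + subst y. rewrite Rmult_0_r, rpow_0; ring.
  - subst x. rewrite Rmult_0_l, rpow_0; ring.
Qed.

Lemma rpow_pow2 (x z : R) : rpow (Rpower 2 x) z = Rpower 2 (x * z).
Proof. rewrite rpow_pos by apply pow2_pos. apply Rpower_mult. Qed.

Lemma rpow_rpow_inv (x z : R) : 0 <= x -> z <> 0 -> rpow (rpow x z) (/ z) = x.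
Proof.
  intros hx hz. destruct (Rle_lt_or_eq_dec 0 x hx) as [h|h].
  - rewrite (rpow_pos x) by auto. rewrite rpow_pos by apply exp_pos.
    rewrite Rpower_mult. replace (z * / z) with 1 by (field; auto). apply Rpower_1; auto.
  - subst x. now rewrite !rpow_0.
Qed.

Lemma rpow_inv_rpow (x z : R) : 0 <= x -> z <> 0 -> rpow (rpow x (/ z)) z = x.
Proof.
  intros hx hz. rewrite <- (Rinv_inv z) at 2. apply rpow_rpow_inv; auto.
  now apply Rinv_neq_0_compat.
Qed.

Lemma Cmod_nonneg (a : Cx) : 0 <= Cmod a.
Proof. apply sqrt_pos. Qed.

Lemma Cmod_mul (a b : Cx) : Cmod (Cmul a b) = Cmod a * Cmod b.
Proof.
  destruct a as [a a'], b as [b b']; unfold Cmod, Cmul; simpl.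
  rewrite <- sqrt_mult by nra. f_equal. ring.
Qed.

Lemma Cmod_C0 : Cmod C0 = 0.
Proof. unfold Cmod, C0; simpl. rewrite Rmult_0_l, Rplus_0_l. apply sqrt_0. Qed.

Lemma Cmod_real (x : R) : 0 <= x -> Cmod (mkC x 0) = x.
Proof.
  intros; unfold Cmod; simpl. replace (x * x + 0 * 0) with (x * x) by ring. now apply sqrt_square.
Qed.

Lemma Cmod_eq_0 (a : Cx) : Cmod a = 0 -> a = C0.
Proof.
  destruct a as [a b]; unfold Cmod, C0; simpl. intros H.
  apply sqrt_eq_0 in H; [|nra]. f_equal; nra.
Qed.

Lemma Cmod_gt_0 (a : Cx) : a <> C0 -> 0 < Cmod a.
Proof.
  intros H. destruct (Cmod_nonneg a) as [h|h]; auto. now elim H; apply Cmod_eq_0.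
Qed.

(* The constant is 2 rather than 1, which avoids Minkowski's inequality. *)
Lemma Cmod_add_le (a b : Cx) : Cmod (Cadd a b) <= 2 * (Cmod a + Cmod b).
Proof.
  assert (h1 := Cmod_nonneg a). assert (h2 := Cmod_nonneg b).
  destruct a as [a a'], b as [b b']; unfold Cmod, Cadd in *; simpl in *.
  assert (e1 : sqrt (a * a + a' * a') * sqrt (a * a + a' * a') = a * a + a' * a') by (apply sqrt_sqrt; nra).
  assert (e2 : sqrt (b * b + b' * b') * sqrt (b * b + b' * b') = b * b + b' * b') by (apply sqrt_sqrt; nra).
  set (u := sqrt (a * a + a' * a')) in *. set (v := sqrt (b * b + b' * b')) in *.
  rewrite <- (sqrt_square (2 * (u + v))) by lra.
  assert (h3 : 0 <= u * v) by (now apply Rmult_le_pos).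
  assert (h4 := Rle_0_sqr (a - b)). assert (h5 := Rle_0_sqr (a' - b')). unfold Rsqr in *.
  apply sqrt_le_1_alt. nra.
Qed.

(** * Finite sums and double series *)

Lemma lsum_app {I : Type} (f : I -> R) l1 l2 : lsum f (l1 ++ l2) = lsum f l1 + lsum f l2.
Proof. induction l1; simpl; [lra|]. fold (lsum f (l1 ++ l2)) (lsum f l1). lra. Qed.

Lemma lsum_cons {I : Type} (f : I -> R) a l : lsum f (a :: l) = f a + lsum f l.
Proof. reflexivity. Qed.

Lemma lsum_le {I : Type} (f g : I -> R) l :
  (forall x, In x l -> f x <= g x) -> lsum f l <= lsum g l.
Proof.
  induction l; intros H; [simpl; lra|]. rewrite !lsum_cons.
  assert (f a <= g a) by (apply H; now left). assert (lsum f l <= lsum g l) by (apply IHl; intros; apply H; now right). lra.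
Qed.

Lemma lsum_ext {I : Type} (f g : I -> R) l :
  (forall x, In x l -> f x = g x) -> lsum f l = lsum g l.
Proof.
  intros H; apply Rle_antisym; apply lsum_le; intros x hx; rewrite (H x hx); lra.
Qed.

Lemma lsum_nonneg {I : Type} (f : I -> R) l : (forall x, 0 <= f x) -> 0 <= lsum f l.
Proof. intros H; induction l; [simpl; lra|]. rewrite lsum_cons. specialize (H a). lra. Qed.

Lemma lsum_scal {I : Type} (c : R) (f : I -> R) l : lsum (fun x => c * f x) l = c * lsum f l.
Proof. induction l; [simpl; ring|]. rewrite !lsum_cons, IHl; ring. Qed.

Lemma lsum_plus {I : Type} (f g : I -> R) l : lsum (fun x => f x + g x) l = lsum f l + lsum g l.
Proof. induction l; [simpl; ring|]. rewrite !lsum_cons, IHl; ring. Qed.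

Lemma lsum_const {I : Type} (c : R) (l : list I) : lsum (fun _ => c) l = INR (length l) * c.
Proof. induction l; [simpl; ring|]. rewrite lsum_cons, IHl. cbn [length]. rewrite S_INR; ring. Qed.

Lemma lsum_map {I J : Type} (g : I -> J) (f : J -> R) l : lsum f (map g l) = lsum (fun x => f (g x)) l.
Proof. induction l; [reflexivity|]. cbn [map]. rewrite !lsum_cons, IHl; ring. Qed.

Lemma lsum_swap {I J : Type} (f : I -> J -> R) l1 l2 :
  lsum (fun x => lsum (f x) l2) l1 = lsum (fun y => lsum (fun x => f x y) l1) l2.
Proof.
  induction l1.
  - simpl. rewrite lsum_const. ring.
  - rewrite lsum_cons, IHl1. rewrite <- lsum_plus. apply lsum_ext; intros; now rewrite lsum_cons.
Qed.

Lemma lsum_flat_map {I J : Type} (g : I -> list J) (f : J -> R) l :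
  lsum f (flat_map g l) = lsum (fun x => lsum f (g x)) l.
Proof. induction l; [reflexivity|]. cbn [flat_map]. now rewrite lsum_app, lsum_cons, IHl. Qed.

Lemma lsum_list_prod {I J : Type} (f : I * J -> R) l1 l2 :
  lsum f (list_prod l1 l2) = lsum (fun x => lsum (fun y => f (x, y)) l2) l1.
Proof.
  induction l1; [reflexivity|]. cbn [list_prod]. now rewrite lsum_app, lsum_cons, lsum_map, IHl1.
Qed.

(** Since [l] has no repetition and [f >= 0], repetitions in [l'] are harmless. Only the support of
    [f] must be found in [l'], so a weight that vanishes off a short list is bounded by its sum over
    that list. *)
Lemma lsum_incl {I : Type} (f : I -> R) l : (forall x, 0 <= f x) -> NoDup l ->
  forall l', (forall x, In x l -> 0 < f x -> In x l') -> lsum f l <= lsum f l'.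
Proof.
  intros Hf. induction 1 as [|a l Ha _ IH]; intros l' Hl.
  - simpl. now apply lsum_nonneg.
  - rewrite lsum_cons. destruct (Hf a) as [h|h].
    + destruct (in_split a l') as [l1 [l2 ->]]. { apply Hl; auto; now left. }
      rewrite lsum_app, lsum_cons. specialize (IH (l1 ++ l2)).
      rewrite lsum_app in IH. enough (lsum f l <= lsum f l1 + lsum f l2) by lra.
      apply IH. intros x hx hfx. assert (hx' : In x (l1 ++ a :: l2)) by (apply Hl; auto; now right).
      apply in_app_iff in hx'. apply in_app_iff. destruct hx' as [|[->|]]; auto. contradiction.
    + rewrite <- h. rewrite Rplus_0_l. apply IH. intros; apply Hl; auto; now right.
Qed.

Lemma sum_f_R0_lsum (f : nat -> R) n : sum_f_R0 f n = lsum f (seq 0 (S n)).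
Proof.
  induction n; [simpl; ring|]. rewrite seq_S, lsum_app, <- IHn. simpl. ring.
Qed.

Lemma lsum_geometric (n : nat) : lsum (fun m => / 2 ^ (S m)) (seq 0 n) <= 1.
Proof.
  enough (lsum (fun m => / 2 ^ (S m)) (seq 0 n) = 1 - / 2 ^ n).
  { assert (0 < / 2 ^ n) by (apply Rinv_0_lt_compat, pow_lt; lra). lra. }
  induction n; [simpl; lra|].
  rewrite seq_S, lsum_app, IHn. simpl. assert (0 < 2 ^ n) by (apply pow_lt; lra). field; lra.
Qed.

(** A Cantor code is at least as large as each of its components, so the pairs with codes
    [0, ..., n] lie in a square of side [n + 1]. *)
Lemma lsum_pairing_le (f : nat -> nat -> R) (M : R) : (forall a b, 0 <= f a b) ->
  (forall n, lsum (fun a => lsum (f a) (seq 0 n)) (seq 0 n) <= M) ->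
  forall n, sum_f_R0 (fun k => f (fst (Cantor.of_nat k)) (snd (Cantor.of_nat k))) n <= M.
Proof.
  intros Hf HM n. rewrite sum_f_R0_lsum.
  rewrite <- (lsum_map Cantor.of_nat (fun ab => f (fst ab) (snd ab))).
  refine (Rle_trans _ _ _ _ (HM (S n))).
  rewrite <- (lsum_list_prod (fun ab => f (fst ab) (snd ab))).
  apply lsum_incl; [intros; apply Hf| |].
  - apply FinFun.Injective_map_NoDup; [|apply seq_NoDup].
    intros x y H. rewrite <- (Cantor.cancel_to_of x), H. apply Cantor.cancel_to_of.
  - intros [a b] H _. apply in_map_iff in H. destruct H as [k [Hk Hin]].
    apply in_seq in Hin. assert (h := Cantor.cancel_to_of k). rewrite Hk in h.
    assert (h' := Cantor.to_nat_non_decreasing a b).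
    apply in_prod; apply in_seq; lia.
Qed.

(** * Finite lists of integer vectors *)

Fixpoint list_funs (d : nat) (l : list Z) : list (Zd d) :=
  match d return list (Zd d) with
  | O => (fun m => Fin.case0 _ m) :: nil
  | S d' => flat_map (fun z => map (fun k m => Fin.caseS' m (fun _ => Z) z k) (list_funs d' l)) l
  end.

Lemma Zd_eta (d : nat) (k : Zd (S d)) :
  k = fun m => Fin.caseS' m (fun _ => Z) (k Fin.F1) (fun m' => k (Fin.FS m')).
Proof. extensionality m. apply (Fin.caseS' m); reflexivity. Qed.

Lemma length_flat_map_const {A B : Type} (g : A -> list B) (l : list A) n :
  (forall x, length (g x) = n) -> length (flat_map g l) = (length l * n)%nat.
Proof. intros H. induction l; [reflexivity|]. simpl. rewrite length_app, H, IHl. lia. Qed.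

Lemma list_funs_length (d : nat) (l : list Z) : length (list_funs d l) = (length l ^ d)%nat.
Proof.
  induction d; [reflexivity|]. simpl. apply length_flat_map_const. intros. now rewrite length_map.
Qed.

Lemma in_list_funs (d : nat) (l : list Z) (k : Zd d) :
  In k (list_funs d l) <-> forall m, In (k m) l.
Proof.
  induction d.
  - split; intros; [apply (Fin.case0 (fun _ => _)); auto|]. left. extensionality m. apply (Fin.case0 (fun _ => _) m).
  - split.
    + intros H m. simpl in H. apply in_flat_map in H. destruct H as [z [Hz H]].
      apply in_map_iff in H. destruct H as [k' [<- H]]. apply (Fin.caseS' m); auto. apply IHd; auto.
    + intros H. simpl. apply in_flat_map. exists (k Fin.F1). split; auto.
      apply in_map_iff. exists (fun m => k (Fin.FS m)). split; [symmetry; apply Zd_eta|].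
      apply IHd; auto.
Qed.

Lemma list_funs_NoDup (d : nat) (l : list Z) : NoDup l -> NoDup (list_funs d l).
Proof.
  intros Hl. induction d; simpl.
  - constructor; [easy|constructor].
  - assert (forall l' : list Z, NoDup l' -> NoDup (flat_map (fun z => map (fun (k : Zd d) m => Fin.caseS' m (fun _ => Z) z k) (list_funs d l)) l')).
    { induction 1 as [|z l' Hz Hl' IH]; simpl; [constructor|].
      apply NoDup_app; auto.
      - apply FinFun.Injective_map_NoDup; auto. intros k k' H. extensionality m.
        exact (f_equal (fun g => g (Fin.FS m)) H).
      - intros k Hk Hk'. apply in_map_iff in Hk. destruct Hk as [k1 [<- _]].
        apply in_flat_map in Hk'. destruct Hk' as [z' [Hz' H']]. apply in_map_iff in H'.
        destruct H' as [k2 [E _]]. apply (f_equal (fun g => g Fin.F1)) in E. simpl in E. now subst. }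
    auto.
Qed.

Definition Zrange (b : nat) : list Z := map (fun n => (Z.of_nat n - Z.of_nat b)%Z) (seq 0 (2 * b + 1)).

Lemma in_Zrange (b : nat) (z : Z) : In z (Zrange b) <-> (Z.abs z <= Z.of_nat b)%Z.
Proof.
  unfold Zrange. rewrite in_map_iff. split.
  - intros [n [<- H]]. apply in_seq in H. lia.
  - intros H. exists (Z.to_nat (z + Z.of_nat b)). split; [lia|]. apply in_seq. lia.
Qed.

Definition box (d b : nat) : list (Zd d) := list_funs d (Zrange b).

Lemma in_box (d b : nat) (k : Zd d) : In k (box d b) <-> forall m, (Z.abs (k m) <= Z.of_nat b)%Z.
Proof. unfold box. rewrite in_list_funs. split; intros H m; apply in_Zrange, H. Qed.

Lemma box_length (d b : nat) : length (box d b) = ((2 * b + 1) ^ d)%nat.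
Proof. unfold box, Zrange. now rewrite list_funs_length, length_map, length_seq. Qed.

Fixpoint fins (n : nat) : list (Fin.t n) :=
  match n with O => nil | S n' => Fin.F1 :: map Fin.FS (fins n') end.

Lemma in_fins (n : nat) (i : Fin.t n) : In i (fins n).
Proof. induction i; [now left|]. right. now apply in_map. Qed.

Lemma fins_length (n : nat) : length (fins n) = n.
Proof. induction n; [reflexivity|]. simpl. now rewrite length_map, IHn. Qed.

Lemma fin_inhabited (n : nat) : (1 <= n)%nat -> exists i : Fin.t n, True.
Proof. destruct n; [lia|]. exists Fin.F1; auto. Qed.

Lemma fin_bound {d : nat} (f : Fin.t d -> R) : exists M : nat, forall m, f m <= INR M.
Proof.
  induction d.
  - exists 0%nat. intros m. apply (Fin.case0 (fun _ => _) m).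
  - destruct (IHd (fun m => f (Fin.FS m))) as [M HM]. destruct (exists_nat_ge (f Fin.F1)) as [M' HM'].
    exists (M + M')%nat. intros m. rewrite plus_INR. assert (h := pos_INR M). assert (h' := pos_INR M').
    apply (Fin.caseS' m); [lra|]. intros m'. specialize (HM m'). lra.
Qed.

Lemma fin_list_bound {A : Type} {d : nat} (l : list A) (f : A -> Fin.t d -> R) :
  exists M : nat, forall a, In a l -> forall m, f a m <= INR M.
Proof.
  induction l as [|a l [M HM]]; [exists 0%nat; easy|].
  destruct (fin_bound (f a)) as [M' HM']. exists (M + M')%nat. intros b [<-|Hb] m;
  rewrite plus_INR; assert (h := pos_INR M); assert (h' := pos_INR M'); [specialize (HM' m)|specialize (HM b Hb m)]; lra.
Qed.

(** A list in [P] that cannot be lengthened exhausts [P]; the induction is on the room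
    [n - length l] left below the bound. *)
Lemma exists_list_of_bounded {A : Type} (P : A -> Prop) (n : nat) :
  (forall l, NoDup l -> (forall x, In x l -> P x) -> (length l <= n)%nat) ->
  exists l, NoDup l /\ (forall x, In x l <-> P x).
Proof.
  intros H.
  enough (E : forall m l, (n - length l = m)%nat -> NoDup l -> (forall x, In x l -> P x) ->
    exists l', NoDup l' /\ (forall x, In x l' <-> P x)).
  { apply (E n nil); [simpl; lia|constructor|easy]. }
  induction m as [m IH] using (well_founded_induction lt_wf).
  intros l Hm Hl HP.
  destruct (excluded_middle_informative (exists x, P x /\ ~ In x l)) as [[x [Hx Hn]]|Hno].
  - assert (NoDup (x :: l)) by (constructor; auto).
    assert (HP' : forall y, In y (x :: l) -> P y) by (intros y [<-|]; auto).
    specialize (H _ H0 HP'). apply (IH (n - length (x :: l))%nat) with (x :: l); auto. simpl in *; lia.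
  - exists l. split; auto. intros x; split; auto. intros Hx.
    destruct (classic (In x l)); auto. elim Hno; eauto.
Qed.

(** * Covers and Hausdorff null sets *)

Definition covered {d : nat} (t delta eps : R) (E : Rd d -> Prop) : Prop :=
  exists (F : nat -> Rd d -> Prop) (r : nat -> R),
    (forall n, 0 <= r n <= delta /\
       forall x y, F n x -> F n y -> forall m, Rabs (x m - y m) <= r n) /\
    (forall x, E x -> exists n, F n x) /\
    (forall n, sum_f_R0 (fun k => rpow (r k) t) n <= eps).

Lemma covered_union {d : nat} (t delta eps : R) (E : nat -> Rd d -> Prop) (e : nat -> R) :
  (forall a, covered t delta (e a) (E a)) -> (forall n, lsum e (seq 0 n) <= eps) ->
  covered t delta eps (fun x => exists a, E a x).
Proof.
  intros H He.
  destruct (choice (fun a (Fr : (nat -> Rd d -> Prop) * (nat -> R)) =>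
    (forall n, 0 <= snd Fr n <= delta /\
       forall x y, fst Fr n x -> fst Fr n y -> forall m, Rabs (x m - y m) <= snd Fr n) /\
    (forall x, E a x -> exists n, fst Fr n x) /\
    (forall n, sum_f_R0 (fun k => rpow (snd Fr k) t) n <= e a))) as [G HG].
  { intros a. destruct (H a) as [F [r Hr]]. exists (F, r). exact Hr. }
  exists (fun k => fst (G (fst (Cantor.of_nat k))) (snd (Cantor.of_nat k))).
  exists (fun k => snd (G (fst (Cantor.of_nat k))) (snd (Cantor.of_nat k))).
  split; [|split].
  - intros n. apply HG.
  - intros x [a Ha]. destruct (HG a) as [_ [H2 _]]. destruct (H2 x Ha) as [b Hb].
    exists (Cantor.to_nat (a, b)). now rewrite Cantor.cancel_of_to.
  - apply (lsum_pairing_le (fun a b => rpow (snd (G a) b) t)); [intros; apply rpow_nonneg|].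
    intros n. refine (Rle_trans _ _ _ _ (He n)). apply lsum_le. intros a _.
    destruct n as [|n]; [|rewrite <- sum_f_R0_lsum; apply HG].
    simpl. destruct (HG a) as [_ [_ H3]]. specialize (H3 0%nat). simpl in H3.
    pose proof (rpow_nonneg (snd (G a) 0%nat) t). lra.
Qed.

Lemma covered_mono {d : nat} (t delta eps eps' : R) (E E' : Rd d -> Prop) :
  (forall x, E x -> E' x) -> eps' <= eps -> covered t delta eps' E' -> covered t delta eps E.
Proof.
  intros HE He [F [r [H1 [H2 H3]]]]. exists F, r. repeat split; try apply H1; auto.
  intros n. specialize (H3 n). lra.
Qed.

Lemma covered_list {d : nat} (t delta r0 : R) (l : list (Rd d -> Prop)) :
  0 <= r0 <= delta ->
  (forall F, In F l -> forall x y, F x -> F y -> forall m, Rabs (x m - y m) <= r0) ->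
  covered t delta (INR (length l) * rpow r0 t) (fun x => exists F, In F l /\ F x).
Proof.
  intros Hr Hl.
  (* Past the end of the list stand empty sets with radius [0], which cost nothing because
     [rpow 0 t = 0]. *)
  exists (fun n => nth n l (fun _ => False)).
  exists (fun n => if Nat.ltb n (length l) then r0 else 0).
  split; [|split].
  - intros n. destruct (Nat.ltb_spec n (length l)).
    + split; auto. apply Hl. now apply nth_In.
    + split; [lra|]. intros x y Hx. rewrite nth_overflow in Hx by auto. easy.
  - intros x [F [HF Hx]]. destruct (In_nth l F (fun _ => False) HF) as [n [_ Hn]]. exists n. now rewrite Hn.
  - intros n. rewrite sum_f_R0_lsum. rewrite <- (length_seq (length l) 0) at 1.
    rewrite <- lsum_const.
    apply Rle_trans with (lsum (fun k => rpow (if Nat.ltb k (length l) then r0 else 0) t) (seq 0 (length l))).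
    + apply lsum_incl; [intros; apply rpow_nonneg|apply seq_NoDup|].
      intros k _. destruct (Nat.ltb_spec k (length l)).
      * intros _; apply in_seq; lia.
      * rewrite rpow_0; lra.
    + apply lsum_le. intros k Hk. destruct (Nat.ltb_spec k (length l)); [lra|]. apply in_seq in Hk; lia.
Qed.

Lemma haus_null_mono {d : nat} (t : R) (E E' : Rd d -> Prop) :
  (forall x, E x -> E' x) -> haus_null t E' -> haus_null t E.
Proof. intros HE H delta hd eps he. apply (covered_mono t delta eps eps E E'); auto; [lra|]. now apply H. Qed.

Lemma haus_null_union {d : nat} (t : R) (E : nat -> Rd d -> Prop) :
  (forall a, haus_null t (E a)) -> haus_null t (fun x => exists a, E a x).
Proof.
  intros H delta hd eps he. apply (covered_union t delta eps E (fun a => eps * / 2 ^ (S a))).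
  - intros a. apply H; auto. apply Rmult_lt_0_compat; auto. apply Rinv_0_lt_compat, pow_lt; lra.
  - intros n. rewrite lsum_scal. pose proof (lsum_geometric n). nra.
Qed.

(** A set of diameter at most [r] lies in the cube of half-side [r] about any of its points, of
    volume [2^d r^d]; hence the budget [eps / 2 ^ d]. The assumption on [d] reconciles
    [rpow 0 (INR d) = 0] with [0 ^ d]. *)
Lemma leb_null_of_haus_null {d : nat} (E : Rd d -> Prop) : (1 <= d)%nat ->
  haus_null (INR d) E -> leb_null E.
Proof.
  intros hd H eps he.
  assert (h2 : 0 < 2 ^ d) by (apply pow_lt; lra).
  destruct (H 1 Rlt_0_1 (eps / 2 ^ d)) as [F [r [H1 [H2 H3]]]].
  { now apply Rdiv_lt_0_compat. }
  assert (HF : forall n, exists a : Rd d, forall x, F n x -> forall m, Rabs (x m - a m) <= r n).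
  { intros n. destruct (classic (exists a, F n a)) as [[a Ha]|Hno].
    - exists a. intros x Hx. now apply H1.
    - exists (fun _ => 0). intros x Hx. elim Hno; eauto. }
  apply choice in HF. destruct HF as [a Ha].
  exists a, r. split; [intros; apply H1|split].
  - intros x Hx. destruct (H2 x Hx) as [n Hn]. exists n. now apply Ha.
  - intros n. specialize (H3 n).
    replace (sum_f_R0 (fun k => (2 * r k) ^ d) n) with (2 ^ d * sum_f_R0 (fun k => rpow (r k) (INR d)) n).
    + apply (Rmult_le_compat_l (2 ^ d)) in H3; [|lra].
      replace (2 ^ d * (eps / 2 ^ d)) with eps in H3 by (field; lra). exact H3.
    + rewrite scal_sum. apply sum_eq. intros k _. rewrite Rpow_mult_distr, Rmult_comm. f_equal.
      destruct (Rle_lt_or_eq_dec 0 (r k)) as [h|h]; [apply H1| |].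
      * rewrite rpow_pos by auto. now apply Rpower_pow.
      * rewrite <- h, rpow_0, pow_ne_zero; auto; lia.
Qed.

(** * Dimension bounds for Besov sequences *)

Lemma fin_uniform {n : nat} (P : Fin.t n -> R -> Prop) :
  (forall i C C', C <= C' -> P i C -> P i C') -> (forall i, exists C, P i C) ->
  exists C, 0 < C /\ forall i, P i C.
Proof.
  intros Hm H. destruct (choice P H) as [f Hf]. destruct (fin_bound f) as [M HM].
  exists (INR M + 1). split; [pose proof (pos_INR M); lra|].
  intros i. apply (Hm i (f i)); auto. specialize (HM i). lra.
Qed.

Lemma bounded_uniform {N d : nat} (psi : Fin.t N -> Rd d -> Cx) :
  (forall i, bounded_fn (psi i)) -> exists C, 0 < C /\ forall i x, Cmod (psi i x) <= C.
Proof.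
  intros H. apply (fin_uniform (fun i C => forall x, Cmod (psi i x) <= C)); auto.
  intros i C C' hC h x. specialize (h x). lra.
Qed.

Lemma decay_uniform {N d : nat} (psi : Fin.t N -> Rd d -> Cx) :
  (forall i, fast_decay (psi i)) ->
  forall m : nat, exists C, 0 < C /\ forall i x n, Cmod (psi i x) * (1 + Rabs (x n)) ^ m <= C.
Proof.
  intros H m. apply (fin_uniform (fun i C => forall x n, Cmod (psi i x) * (1 + Rabs (x n)) ^ m <= C)).
  - intros i C C' hC h x n. specialize (h x n). lra.
  - intros i. apply (H i m).
Qed.

Lemma in_lq_bounded (A : nat -> R) (q : option R) : (forall j, 0 <= A j) -> ext_pos q ->
  in_lq A q -> exists M, 0 <= M /\ forall j, A j <= M.
Proof.
  intros HA Hq H. destruct q as [q|]; simpl in *; destruct H as [M H].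
  - exists (rpow M (/ q)). split; [apply rpow_nonneg|]. intros j.
    rewrite <- (rpow_rpow_inv (A j) q) by (auto; lra).
    apply rpow_le; [|now apply Rinv_0_lt_compat]. split; [apply rpow_nonneg|].
    apply Rle_trans with (2 := H j). rewrite sum_f_R0_lsum, seq_S, lsum_app. simpl.
    pose proof (lsum_nonneg (fun j => rpow (A j) q) (seq 0 j) (fun j => rpow_nonneg (A j) q)). lra.
  - exists M. split; auto. specialize (H 0%nat). specialize (HA 0%nat). lra.
Qed.

Lemma layer_norm_nonneg {N d : nat} (c : cseq N d) p s j A : (1 <= N)%nat ->
  layer_norm c p s j A -> 0 <= A.
Proof.
  intros hN. destruct p as [r|]; simpl.
  - intros [u [_ ->]]. apply rpow_nonneg.
  - intros [H _]. destruct (fin_inhabited N hN) as [i _].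
    refine (Rle_trans _ _ _ _ (H _ (ex_intro _ i (ex_intro _ (fun _ => 0%Z) eq_refl)))).
    apply Rmult_le_pos; [apply Cmod_nonneg|left; apply pow2_pos].
Qed.

(** The embedding of [b^{s,q}_p] into [b^{s,oo}_p]; the upper bounds on exponents and dimensions see
    [q] only through it. *)
Lemma besov_bounded_layers {N d : nat} s p q (c : cseq N d) : (1 <= N)%nat -> ext_pos q ->
  in_besov s p q c -> exists M, 0 <= M /\ forall j, exists A, A <= M /\ layer_norm c p s j A.
Proof.
  intros hN hq [A [HA Hl]].
  destruct (in_lq_bounded A q) as [M [HM H]]; auto.
  { intros j. eapply layer_norm_nonneg; eauto. }
  exists M. split; auto. intros j. exists (A j). auto.
Qed.

Lemma besov_layer_sum {N d : nat} s r q (c : cseq N d) : (1 <= N)%nat -> ext_pos q -> 0 < r ->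
  in_besov s (Some r) q c -> exists M, 0 <= M /\ forall j l, NoDup l ->
    lsum (fun ik => rpow (Cmod (c (fst ik) j (snd ik)) *
                          Rpower 2 ((s - INR d / r) * INR j)) r) l <= M.
Proof.
  intros hN hq hr H. destruct (besov_bounded_layers _ _ _ _ hN hq H) as [M [HM HA]].
  exists (rpow M r). split; [apply rpow_nonneg|].
  intros j l Hl. destruct (HA j) as [A [hA [u [[Hu _] EA]]]].
  assert (h : lsum (fun ik => rpow (Cmod (c (fst ik) j (snd ik)) *
                          Rpower 2 ((s - INR d / r) * INR j)) r) l <= u) by (apply Hu; eauto).
  apply Rle_trans with (1 := h).
  assert (0 <= u). { refine (Rle_trans _ _ _ _ h). apply lsum_nonneg. intros; apply rpow_nonneg. }
  rewrite <- (rpow_inv_rpow u r) by (auto; lra). apply rpow_le; auto. split; [apply rpow_nonneg|lra].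
Qed.

(** The embedding into [b^{s-d/p,oo}_oo]: one coefficient is at most the norm of its layer, so the
    layer sum is read on a one-element list. *)
Lemma besov_coef_bound {N d : nat} s p q (c : cseq N d) : (1 <= N)%nat -> ext_pos p -> ext_pos q ->
  in_besov s p q c -> exists M, 0 < M /\ forall i j k,
    Cmod (c i j k) <= M * Rpower 2 ((d_over d p - s) * INR j).
Proof.
  intros hN hp hq H. destruct p as [r|]; simpl in *.
  - destruct (besov_layer_sum _ _ _ _ hN hq hp H) as [M [HM HS]].
    exists (rpow M (/ r) + 1). pose proof (rpow_nonneg M (/ r)). split; [lra|].
    intros i j k. specialize (HS j ((i, k) :: nil)). simpl in HS.
    assert (h : rpow (Cmod (c i j k) * Rpower 2 ((s - INR d / r) * INR j)) r <= M).
    { rewrite Rplus_0_r in HS. apply HS. constructor; [easy|constructor]. }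
    assert (h' : Cmod (c i j k) * Rpower 2 ((s - INR d / r) * INR j) <= rpow M (/ r)).
    { rewrite <- (rpow_rpow_inv (Cmod (c i j k) * Rpower 2 ((s - INR d / r) * INR j)) r).
      - apply rpow_le; [|now apply Rinv_0_lt_compat]. split; auto. apply rpow_nonneg.
      - apply Rmult_le_pos; [apply Cmod_nonneg|left; apply pow2_pos].
      - lra. }
    replace ((INR d / r - s) * INR j) with (- ((s - INR d / r) * INR j)) by ring.
    pose proof (pow2_pos ((s - INR d / r) * INR j)).
    pose proof (pow2_opp_mult ((s - INR d / r) * INR j)).
    set (X := Rpower 2 ((s - INR d / r) * INR j)) in *. set (Y := Rpower 2 (- _)) in *.
    replace (Cmod (c i j k)) with (Cmod (c i j k) * X * Y) by (rewrite Rmult_assoc, H2; ring).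
    assert (0 < Y) by apply pow2_pos. nra.
  - destruct (besov_bounded_layers _ _ _ _ hN hq H) as [M [HM HA]].
    exists (M + 1). split; [lra|]. intros i j k. destruct (HA j) as [A [hA [Hu _]]].
    specialize (Hu _ (ex_intro _ i (ex_intro _ k eq_refl))).
    replace ((0 - s) * INR j) with (- (s * INR j)) by ring.
    pose proof (pow2_pos (s * INR j)).
    pose proof (pow2_opp_mult (s * INR j)).
    set (X := Rpower 2 (s * INR j)) in *. set (Y := Rpower 2 (- _)) in *.
    replace (Cmod (c i j k)) with (Cmod (c i j k) * X * Y) by (rewrite Rmult_assoc, H1; ring).
    assert (0 < Y) by apply pow2_pos. nra.
Qed.

(** Markov's inequality: each coefficient of size at least [y 2^(g j)] contributes at least
    [y^r 2^((g r + s r - d) j)] to a layer sum that is bounded uniformly in [j]. *)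
Lemma besov_count {N d : nat} s r q (c : cseq N d) : (1 <= N)%nat -> ext_pos q -> 0 < r ->
  in_besov s (Some r) q c -> forall g y, 0 < y ->
  exists M, 0 < M /\ forall j, exists l : list (Fin.t N * Zd d),
    (forall i k, y * Rpower 2 (g * INR j) <= Cmod (c i j k) -> In (i, k) l) /\
    INR (length l) <= M * Rpower 2 ((INR d - s * r - g * r) * INR j).
Proof.
  intros hN hq hr H g y hy. destruct (besov_layer_sum _ _ _ _ hN hq hr H) as [M0 [HM0 HS]].
  assert (hyr : 0 < rpow y r) by now apply rpow_gt_0.
  exists (M0 / rpow y r + 1). split.
  { assert (0 <= M0 / rpow y r) by (apply Rle_mult_inv_pos; lra). lra. }
  intros j.
  set (P := fun ik : Fin.t N * Zd d => y * Rpower 2 (g * INR j) <= Cmod (c (fst ik) j (snd ik))).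
  assert (HP : forall l, NoDup l -> (forall x, In x l -> P x) ->
     INR (length l) <= (M0 / rpow y r + 1) * Rpower 2 ((INR d - s * r - g * r) * INR j)).
  { intros l Hl HP. specialize (HS j l Hl).
    assert (h : INR (length l) * (rpow y r * Rpower 2 (- ((INR d - s * r - g * r) * INR j))) <= M0).
    { refine (Rle_trans _ _ _ _ HS). rewrite <- lsum_const. apply lsum_le. intros ik Hik.
      replace (- ((INR d - s * r - g * r) * INR j)) with ((g * INR j + (s - INR d / r) * INR j) * r)
        by (field; lra).
      rewrite <- rpow_pow2, <- rpow_mult by (try lra; left; apply pow2_pos).
      rewrite pow2_plus, <- Rmult_assoc. apply rpow_le; auto. pose proof (pow2_pos (g * INR j)).
      pose proof (pow2_pos ((s - INR d / r) * INR j)). split.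
      - apply Rmult_le_pos; [apply Rmult_le_pos|]; lra.
      - apply Rmult_le_compat_r; [lra|]. apply HP; auto. }
    pose proof (pow2_opp_mult ((INR d - s * r - g * r) * INR j)).
    pose proof (pow2_pos ((INR d - s * r - g * r) * INR j)).
    set (X := Rpower 2 ((INR d - s * r - g * r) * INR j)) in *. set (Y := Rpower 2 (- _)) in *.
    apply (Rmult_le_compat_r (X / rpow y r)) in h; [|apply Rle_mult_inv_pos; lra].
    replace (INR (length l) * (rpow y r * Y) * (X / rpow y r)) with (INR (length l) * (X * Y)) in h by (field; lra).
    rewrite H0 in h. replace (M0 * (X / rpow y r)) with (M0 / rpow y r * X) in h by (field; lra). lra. }
  destruct (exists_nat_ge ((M0 / rpow y r + 1) * Rpower 2 ((INR d - s * r - g * r) * INR j))) as [n Hn].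
  destruct (exists_list_of_bounded P n) as [l [Hl HlP]].
  { intros l Hl Hp. apply INR_le. specialize (HP l Hl Hp). lra. }
  exists l. split.
  - intros i k hik. apply HlP. exact hik.
  - apply HP; auto. apply HlP.
Qed.

Lemma lsum_pow2_bound (a : R) : 0 < a ->
  exists M, 0 < M /\ forall n, lsum (fun j => Rpower 2 (- a * INR j)) (seq 0 n) <= M.
Proof.
  intros ha. set (x := Rpower 2 (- a)).
  assert (hx : 0 < x < 1).
  { split; [apply pow2_pos|]. rewrite <- pow2_0. apply Rpower_lt; lra. }
  exists (/ (1 - x)). split; [apply Rinv_0_lt_compat; lra|]. intros n.
  enough (E : lsum (fun j => Rpower 2 (- a * INR j)) (seq 0 n) = (1 - x ^ n) / (1 - x)).
  { rewrite E. unfold Rdiv. rewrite <- (Rmult_1_l (/ (1 - x))) at 2.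
    apply Rmult_le_compat_r; [left; apply Rinv_0_lt_compat; lra|].
    assert (0 < x ^ n) by (apply pow_lt; lra). lra. }
  induction n; [simpl; field; lra|].
  rewrite seq_S, lsum_app, IHn. cbn [lsum fold_right plus].
  rewrite <- Rpower_mult. fold x. rewrite Rpower_pow by lra. simpl. field; lra.
Qed.

Lemma div_set_mono {N d : nat} (psi : Fin.t N -> Rd d -> Cx) c x g g' :
  g' <= g -> div_set psi c x g -> div_set psi c x g'.
Proof.
  intros hg [C [hC [i_ [j_ [k_ [Hj H]]]]]]. exists C. split; auto. exists i_, j_, k_. split; auto.
  intros n. specialize (H n). apply Rge_le in H. apply Rle_ge. refine (Rle_trans _ _ _ _ H).
  apply Rmult_le_compat_l; [lra|]. apply pow2_le. apply Rmult_le_compat_r; [apply pos_INR|auto].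
Qed.

(** Lowering [g] to [g'] absorbs the constant [C], because [2^(-(g - g') j)] falls below [C] for
    large [j]. *)
Lemma div_set_eventually {N d : nat} (psi : Fin.t N -> Rd d -> Cx) c x g g' (J : nat) :
  g' < g -> div_set psi c x g ->
  exists i j k, (J <= j)%nat /\
    Rpower 2 (g' * INR j) <= Cmod (c i j k) * Cmod (psi i (dil j k x)).
Proof.
  intros hg [C [hC [i_ [j_ [k_ [Hj H]]]]]].
  destruct (pow2_small (g - g') C) as [n0 Hn0]; [lra..|].
  destruct (Hj (Nat.max n0 J)) as [n1 Hn1]. specialize (Hn1 n1 (le_n _)).
  exists (i_ n1), (j_ n1), (k_ n1). split; [lia|].
  specialize (H n1). apply Rge_le in H. refine (Rle_trans _ _ _ _ H).
  replace (g' * INR (j_ n1)) with (- (g - g') * INR (j_ n1) + g * INR (j_ n1)) by ring.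
  rewrite pow2_plus. apply Rmult_le_compat_r; [left; apply pow2_pos|]. apply Hn0; lia.
Qed.

Lemma div_set_le {N d : nat} (psi : Fin.t N -> Rd d -> Cx) (c : cseq N d) (h M : R) :
  (forall i, bounded_fn (psi i)) ->
  (forall i j k, Cmod (c i j k) <= M * Rpower 2 (h * INR j)) ->
  forall x g, div_set psi c x g -> g <= h.
Proof.
  intros hb HM x g Hg. destruct (Rle_or_lt g h) as [|hlt]; auto. exfalso.
  destruct (bounded_uniform psi hb) as [Cp [hCp HCp]].
  set (g' := (g + h) / 2).
  assert (hM : 0 <= M). {
    destruct Hg as [C [hC [i_ [j_ [k_ [_ _]]]]]].
    specialize (HM (i_ 0%nat) (j_ 0%nat) (k_ 0%nat)). pose proof (Cmod_nonneg (c (i_ 0%nat) (j_ 0%nat) (k_ 0%nat))).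
    pose proof (pow2_pos (h * INR (j_ 0%nat))). nra. }
  destruct (pow2_small (g' - h) (/ (2 * (M * Cp + 1)))) as [n0 Hn0].
  { unfold g'; lra. } { apply Rinv_0_lt_compat. nra. }
  destruct (div_set_eventually psi c x g g' n0) as [i [j [k [hj H]]]]; auto.
  { unfold g'; lra. }
  specialize (Hn0 j hj). specialize (HM i j k). specialize (HCp i (dil j k x)).
  pose proof (Cmod_nonneg (c i j k)). pose proof (Cmod_nonneg (psi i (dil j k x))).
  assert (H2 : Rpower 2 (g' * INR j) <= M * Cp * Rpower 2 (h * INR j)).
  { apply Rle_trans with (1 := H). replace (M * Cp * Rpower 2 (h * INR j)) with (M * Rpower 2 (h * INR j) * Cp) by ring.
    apply Rmult_le_compat; auto. }
  replace (h * INR j) with (- (g' - h) * INR j + g' * INR j) in H2 by ring.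
  rewrite pow2_plus in H2. pose proof (pow2_pos (g' * INR j)).
  set (X := Rpower 2 (g' * INR j)) in *. set (Y := Rpower 2 (- (g' - h) * INR j)) in *.
  assert (M * Cp >= 0) by nra.
  assert (M * Cp * Y <= / 2).
  { apply Rle_trans with (M * Cp * / (2 * (M * Cp + 1))). apply Rmult_le_compat_l; lra.
    apply Rmult_le_reg_r with (2 * (M * Cp + 1)); [lra|]. field_simplify; lra. }
  nra.
Qed.

(* Fast decay confines the wavelets that matter at [x] to a neighbourhood of [x] of radius
   [2^(eps j)] in units of [2^(-j)], and the Besov norm bounds the number of large coefficients. *)
Lemma div_set_haus_null {N d : nat} (psi : Fin.t N -> Rd d -> Cx) s r q (c : cseq N d) :
  (1 <= N)%nat -> (forall i, bounded_fn (psi i)) -> (forall i, fast_decay (psi i)) ->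
  ext_pos q -> 0 < r -> in_besov s (Some r) q c ->
  forall g t, 0 < t -> INR d - s * r - g * r < t -> haus_null t (fun x => div_set psi c x g).
Proof.
  intros hN hb hd hq hr Hc g t ht hgt delta hdelta eps0 heps0.
  (* [D] is the slack in dimension. Lowering [g] to [g'] spends [D / 2] of it and widening the
     neighbourhoods by [2^(e j)] at most [D / 4]; what remains, [ka >= D / 4], is the rate at which
     the cost of layer [j] decays. *)
  set (D := t - (INR d - s * r - g * r)). assert (hD : 0 < D) by (unfold D; lra).
  set (g' := g - D / (2 * r)).
  assert (hg' : g' < g). { unfold g'. assert (0 < D / (2 * r)) by (apply Rdiv_lt_0_compat; lra). lra. }
  assert (he : INR d - s * r - g' * r = t - D / 2). { unfold g', D. field. lra. }
  set (e := Rmin (1 / 2) (D / (4 * t))).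
  assert (he0 : 0 < e). { unfold e. apply Rmin_glb_lt; [lra|]. apply Rdiv_lt_0_compat; lra. }
  assert (he1 : e <= 1 / 2) by apply Rmin_l.
  assert (he2 : t * e <= D / 4).
  { replace (D / 4) with (t * (D / (4 * t))) by (field; lra). apply Rmult_le_compat_l; [lra|]. apply Rmin_r. }
  set (ka := t * (1 - e) - (t - D / 2)). assert (hka : 0 < ka) by (unfold ka; lra).
  destruct (bounded_uniform psi hb) as [Cp [hCp HCp]].
  destruct (besov_coef_bound s (Some r) q c hN hr hq Hc) as [M [hM HM]]. simpl in HM.
  destruct (besov_count s r q c hN hq hr Hc g' (/ Cp)) as [M1 [hM1 Hcount]].
  { now apply Rinv_0_lt_compat. }
  (* With decay of order [m0], the factor [2^(- e m0 j)] brings the largest possible coefficient, of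
     order [2^((d/r - s) j)], down to [2^((g' - 1) j)], well below the threshold [2^(g' j)]. *)
  destruct (exists_nat_ge ((INR d / r - s - g' + 1) / e)) as [m0 Hm0].
  assert (Hm0' : INR d / r - s - g' + 1 <= e * INR m0).
  { apply (Rmult_le_compat_l e) in Hm0; [|lra]. replace (e * ((INR d / r - s - g' + 1) / e)) with (INR d / r - s - g' + 1) in Hm0 by (field; lra). auto. }
  destruct (decay_uniform psi hd m0) as [Cd [hCd HCd]].
  destruct (lsum_pow2_bound ka hka) as [M2 [hM2 HM2]].
  assert (hMC : 0 < M * Cd) by now apply Rmult_lt_0_compat.
  destruct (pow2_small 1 (/ (2 * (M * Cd)))) as [n1 Hn1]; [lra|apply Rinv_0_lt_compat; lra|].
  destruct (pow2_small (1 - e) (delta / 2)) as [n2 Hn2]; [lra..|].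
  assert (hMt : 0 < M1 * Rpower 2 t * M2). { pose proof (pow2_pos t). repeat apply Rmult_lt_0_compat; auto. }
  destruct (pow2_small ka (eps0 / (M1 * Rpower 2 t * M2))) as [n3 Hn3]; [lra|now apply Rdiv_lt_0_compat|].
  (* From layer [J] on, [n1] makes wavelets centred far from [x] too small to count and [n2] brings
     the radii below [delta]; [n3] brings the total cost below [eps0]. *)
  set (J := (n1 + n2 + n3)%nat).
  set (rad := fun j => Rpower 2 (1 - (1 - e) * INR j)).
  assert (Hcov : forall a, covered t delta (M1 * Rpower 2 t * Rpower 2 (- ka * INR (J + a)))
    (fun x => exists i k, Rpower 2 (g' * INR (J + a)) <= Cmod (c i (J + a)%nat k) * Cmod (psi i (dil (J + a) k x)))).
  { intros a. set (j := (J + a)%nat). destruct (Hcount j) as [l [Hl Hlen]].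
    set (ball := fun (ik : Fin.t N * Zd d) (x : Rd d) => forall m, Rabs (dil j (snd ik) x m) <= Rpower 2 (e * INR j)).
    assert (hrad : 0 <= rad j <= delta).
    { split; [left; apply pow2_pos|]. unfold rad, Rminus at 1. rewrite pow2_plus, Rpower_1 by lra.
      replace (- ((1 - e) * INR j)) with (- (1 - e) * INR j) by ring.
      specialize (Hn2 j). assert (n2 <= j)%nat by (unfold j, J; lia). specialize (Hn2 H). lra. }
    apply (covered_mono t delta _ (INR (length (map ball l)) * rpow (rad j) t) _ (fun x => exists F, In F (map ball l) /\ F x)).
    - intros x [i [k Hx]]. exists (ball (i, k)).
      pose proof (Cmod_nonneg (c i j k)) as hc. pose proof (Cmod_nonneg (psi i (dil j k x))) as hp.
      split.
      + apply in_map. apply Hl. specialize (HCp i (dil j k x)).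
        apply Rmult_le_reg_l with Cp; auto. rewrite <- Rmult_assoc, Rinv_r, Rmult_1_l by lra.
        fold j in Hx. nra.
      + intros m. simpl. destruct (Rle_or_lt (Rabs (dil j k x m)) (Rpower 2 (e * INR j))) as [|hlt]; auto. exfalso.
        specialize (HCd i (dil j k x) m). specialize (HM i j k).
        pose proof (pow2_pos (e * INR j)) as hY.
        assert (h1 : Rpower 2 (e * INR j * INR m0) <= (1 + Rabs (dil j k x m)) ^ m0).
        { rewrite <- Rpower_mult, Rpower_pow by auto. apply pow_incr. lra. }
        assert (h2 : Cmod (psi i (dil j k x)) * Rpower 2 (e * INR j * INR m0) <= Cd).
        { refine (Rle_trans _ _ _ _ HCd). apply Rmult_le_compat_l; auto. }
        assert (h3 : Rpower 2 (g' * INR j) * Rpower 2 (e * INR j * INR m0) <= M * Rpower 2 ((INR d / r - s) * INR j) * Cd).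
        { apply Rle_trans with (Cmod (c i j k) * Cmod (psi i (dil j k x)) * Rpower 2 (e * INR j * INR m0)).
          - apply Rmult_le_compat_r; auto. left; apply pow2_pos.
          - rewrite Rmult_assoc. apply Rmult_le_compat; auto. apply Rmult_le_pos; auto. left; apply pow2_pos. }
        rewrite <- pow2_plus in h3.
        assert (h4 : Rpower 2 ((INR d / r - s) * INR j + INR j) <= Rpower 2 (g' * INR j + e * INR j * INR m0)).
        { apply pow2_le. pose proof (pos_INR j). nra. }
        rewrite pow2_plus in h4.
        specialize (Hn1 j). assert (hj : (n1 <= j)%nat) by (unfold j, J; lia). specialize (Hn1 hj).
        replace (Rpower 2 (- (1) * INR j)) with (Rpower 2 (- INR j)) in Hn1 by (f_equal; ring).
        pose proof (pow2_opp_mult (INR j)) as h5.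
        pose proof (pow2_pos ((INR d / r - s) * INR j)) as h6.
        set (Z := Rpower 2 ((INR d / r - s) * INR j)) in *.
        assert (h7 : Rpower 2 (INR j) <= M * Cd).
        { apply Rmult_le_reg_l with Z; auto. nra. }
        pose proof (pow2_pos (INR j)) as h8. pose proof (pow2_pos (- INR j)) as h9.
        assert (h10 : M * Cd * Rpower 2 (- INR j) <= / 2).
        { apply (Rmult_le_compat_l (M * Cd)) in Hn1; [|lra]. replace (M * Cd * / (2 * (M * Cd))) with (/ 2) in Hn1 by (field; nra). exact Hn1. }
        nra.
    - rewrite length_map. unfold rad. rewrite rpow_pow2.
      apply Rle_trans with (M1 * Rpower 2 ((INR d - s * r - g' * r) * INR j) * Rpower 2 ((1 - (1 - e) * INR j) * t)).
      + apply Rmult_le_compat_r; auto. left; apply pow2_pos.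
      + rewrite !Rmult_assoc, <- !pow2_plus. right. do 2 f_equal. rewrite he. unfold ka. ring.
    - apply covered_list; auto. intros F HF x y Hx Hy m. apply in_map_iff in HF. destruct HF as [[i k] [<- _]].
      specialize (Hx m). specialize (Hy m). unfold dil in Hx, Hy. simpl in Hx, Hy.
      unfold rad. replace (1 - (1 - e) * INR j) with (1 + (e * INR j + - INR j)) by ring.
      rewrite !pow2_plus, Rpower_1 by lra.
      pose proof (pow2_opp_mult (INR j)) as h5. rewrite pow2_INR in h5.
      assert (h2j : 0 < 2 ^ j) by (apply pow_lt; lra).
      apply Rmult_le_reg_l with (2 ^ j); auto.
      rewrite <- (Rabs_pos_eq (2 ^ j)) at 1 by lra. rewrite <- Rabs_mult.
      replace (2 ^ j * (2 * (Rpower 2 (e * INR j) * Rpower 2 (- INR j)))) with (2 * Rpower 2 (e * INR j)).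
      + replace (2 ^ j * (x m - y m)) with ((2 ^ j * x m - IZR (k m)) - (2 ^ j * y m - IZR (k m))) by ring.
        apply Rabs_le_inv in Hx. apply Rabs_le_inv in Hy. apply Rabs_le. lra.
      + replace (2 ^ j * (2 * (Rpower 2 (e * INR j) * Rpower 2 (- INR j)))) with (2 * Rpower 2 (e * INR j) * (2 ^ j * Rpower 2 (- INR j))) by ring.
        rewrite h5. ring. }
  refine (covered_mono t delta eps0 eps0 _ _ _ (Rle_refl _) (covered_union t delta eps0 _ _ Hcov _)).
  - intros x Hx. destruct (div_set_eventually psi c x g g' J hg' Hx) as [i [j [k [hj H]]]].
    exists (j - J)%nat. replace (J + (j - J))%nat with j by lia. eauto.
  - intros n. rewrite lsum_scal.
    rewrite (lsum_ext _ (fun a => Rpower 2 (- ka * INR J) * Rpower 2 (- ka * INR a))).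
    + rewrite lsum_scal. specialize (HM2 n). specialize (Hn3 J). assert (hJ : (n3 <= J)%nat) by (unfold J; lia).
      specialize (Hn3 hJ). pose proof (pow2_pos (- ka * INR J)). pose proof (pow2_pos t).
      assert (h0 : 0 < M1 * Rpower 2 t) by now apply Rmult_lt_0_compat.
      apply Rle_trans with (M1 * Rpower 2 t * (eps0 / (M1 * Rpower 2 t * M2) * M2)).
      * apply Rmult_le_compat_l; [lra|]. apply Rmult_le_compat; auto; [lra|]. apply lsum_nonneg. intros; left; apply pow2_pos.
      * right. field. repeat split; lra.
    + intros a _. rewrite <- pow2_plus. f_equal. rewrite plus_INR. ring.
Qed.

(** * Cantor sets of binary digits *)

Lemma pow2_opp_INR (n : nat) : Rpower 2 (- INR n) = / 2 ^ n.
Proof. now rewrite Rpower_Ropp, pow2_INR. Qed.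

Fixpoint cnt (free : nat -> bool) (n : nat) : nat :=
  match n with O => O | S n' => (cnt free n' + if free n' then 1 else 0)%nat end.

(** The probability of a cube of generation [n] when the free digits are drawn uniformly: the
    natural measure of the Cantor set, evaluated on cubes only. *)
Definition mass (d : nat) (free : nat -> bool) (n : nat) : R := / 2 ^ (d * cnt free n).

Lemma mass_pos d free n : 0 < mass d free n.
Proof. apply Rinv_0_lt_compat, pow_lt; lra. Qed.

Definition bits (d : nat) : list (Zd d) := list_funs d (0%Z :: 1%Z :: nil).

Definition child {d : nat} (P b : Zd d) : Zd d := fun m => (2 * P m + b m)%Z.

(** [P] stands for the cube with corner [P 2^(-n)]. A forced digit keeps only the subcube with the
    same corner, so a run of forced digits holds points close to a dyadic point. *)
Definition children {d : nat} (free : nat -> bool) (n : nat) (P : Zd d) : list (Zd d) :=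
  if free n then map (child P) (bits d) else child P (fun _ => 0%Z) :: nil.

Lemma in_children {d : nat} free n (P P' : Zd d) : In P' (children free n P) ->
  forall m, (P' m = 2 * P m \/ P' m = 2 * P m + 1)%Z.
Proof.
  unfold children. destruct (free n).
  - intros H m. apply in_map_iff in H. destruct H as [b [<- H]].
    apply (proj1 (in_list_funs _ _ _)) with (m := m) in H. unfold child. simpl in H. lia.
  - intros [<-|[]] m. unfold child. lia.
Qed.

Lemma children_NoDup {d : nat} free n (P : Zd d) : NoDup (children free n P).
Proof.
  unfold children. destruct (free n).
  - apply FinFun.Injective_map_NoDup.
    + intros b b' H. extensionality m. apply (f_equal (fun g => g m)) in H. unfold child in H. lia.
    + apply list_funs_NoDup. constructor; [simpl; intuition lia|]. constructor; [easy|constructor].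
  - constructor; [easy|constructor].
Qed.

Lemma children_mass {d : nat} free n (P : Zd d) :
  INR (length (children free n P)) * mass d free (S n) = mass d free n.
Proof.
  unfold children, mass. simpl. destruct (free n).
  - rewrite length_map. unfold bits. rewrite list_funs_length. simpl length.
    rewrite pow_INR, Nat.mul_add_distr_l, Nat.mul_1_r, pow_add. simpl.
    replace (1 + 1) with 2 by ring.
    assert (0 < 2 ^ (d * cnt free n)) by (apply pow_lt; lra).
    assert (0 < 2 ^ d) by (apply pow_lt; lra). field. lra.
  - rewrite Nat.add_0_r. simpl. ring.
Qed.

(** The pair [e = (l, Q)] is a cube of generation [l], and the floor division by [2^(l - n)] yields
    its ancestor of generation [n]. The weight is the mass of [e] if that ancestor is [P]. Cubes of
    generation below [n] weigh nothing: during a descent, listed cubes that have been passed are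
    forgotten. *)
Definition cylinder_weight {d : nat} (free : nat -> bool) (n : nat) (P : Zd d) (e : nat * Zd d) : R :=
  if excluded_middle_informative
       ((n <= fst e)%nat /\ forall m, (snd e m / 2 ^ Z.of_nat (fst e - n) = P m)%Z)
  then mass d free (fst e) else 0.

Lemma cylinder_weight_nonneg {d : nat} free n (P : Zd d) e : 0 <= cylinder_weight free n P e.
Proof.
  unfold cylinder_weight. destruct (excluded_middle_informative _); [|lra]. left; apply mass_pos.
Qed.

Lemma cylinder_weight_le {d : nat} free n (P : Zd d) e : cylinder_weight free n P e <= mass d free (fst e).
Proof.
  unfold cylinder_weight. destruct (excluded_middle_informative _); [lra|]. left; apply mass_pos.
Qed.

(** A cube has only one ancestor of generation [n + 1], so at most one child carries its weight, and
    then [P] carries it too. *)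
Lemma cylinder_weight_children {d : nat} free n (P : Zd d) e :
  lsum (fun P' => cylinder_weight free (S n) P' e) (children free n P) <= cylinder_weight free n P e.
Proof.
  destruct e as [l Q].
  set (P1 := (fun m => Q m / 2 ^ Z.of_nat (l - S n))%Z : Zd d).
  assert (H : forall P', 0 < cylinder_weight free (S n) P' (l, Q) -> (S n <= l)%nat /\ P' = P1).
  { intros P'. unfold cylinder_weight. simpl. destruct (excluded_middle_informative _) as [[h1 h2]|]; [|lra].
    intros _. split; auto. extensionality m. symmetry; apply h2. }
  destruct (classic (In P1 (children free n P) /\ (S n <= l)%nat)) as [[Hin hl]|Hno].
  - apply Rle_trans with (lsum (fun P' => cylinder_weight free (S n) P' (l, Q)) (P1 :: nil)).
    + apply lsum_incl; [intros; apply cylinder_weight_nonneg|apply children_NoDup|].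
      intros P' _ hP'. left. symmetry. now apply H.
    + simpl. rewrite Rplus_0_r. apply Rle_trans with (1 := cylinder_weight_le _ _ _ _).
      unfold cylinder_weight. simpl. destruct (excluded_middle_informative _) as [|Hn]; [lra|].
      elim Hn. split; [lia|]. intros m.
      destruct (in_children free n P P1 Hin m) as [E|E]; unfold P1 in E;
      replace (l - n)%nat with (l - S n + 1)%nat by lia;
      rewrite Nat2Z.inj_add, Z.pow_add_r, <- Z.div_div by lia;
      rewrite E; change (2 ^ Z.of_nat 1)%Z with 2%Z.
      * rewrite Z.mul_comm. apply Z.div_mul; lia.
      * rewrite Z.mul_comm, Z.div_add_l by lia. change (1 / 2)%Z with 0%Z. lia.
  - apply Rle_trans with (lsum (fun P' => cylinder_weight free (S n) P' (l, Q)) nil).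
    + apply lsum_incl; [intros; apply cylinder_weight_nonneg|apply children_NoDup|].
      intros P' hin hP'. apply H in hP'. destruct hP' as [hl ->]. now elim Hno.
    + apply cylinder_weight_nonneg.
Qed.

Definition load {d : nat} (free : nat -> bool) (n : nat) (P : Zd d) (E : list (nat * Zd d)) : R :=
  lsum (cylinder_weight free n P) E.

Lemma load_children {d : nat} free n (P : Zd d) E :
  lsum (fun P' => load free (S n) P' E) (children free n P) <= load free n P E.
Proof.
  unfold load. rewrite lsum_swap. apply lsum_le. intros e _. apply cylinder_weight_children.
Qed.

Lemma load_ge_of_in {d : nat} free n (P : Zd d) E : In (n, P) E -> mass d free n <= load free n P E.
Proof.
  intros H. replace (mass d free n) with (lsum (cylinder_weight free n P) ((n, P) :: nil)).
  - apply lsum_incl; [intros; apply cylinder_weight_nonneg| |].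
    + constructor; [easy|constructor].
    + intros e [<-|[]] _. auto.
  - simpl. unfold cylinder_weight. simpl. destruct (excluded_middle_informative _) as [|Hn]; [ring|].
    elim Hn. split; [lia|]. intros m. rewrite Nat.sub_diag. simpl. apply Z.div_1_r.
Qed.

Lemma exists_common_bound {A : Type} (P : A -> nat -> Prop) (l : list A) :
  (forall x M M', (M <= M')%nat -> P x M -> P x M') ->
  (forall x, In x l -> exists M, P x M) -> exists M, forall x, In x l -> P x M.
Proof.
  intros Hm. induction l as [|a l IH]; intros H; [exists 0%nat; easy|].
  destruct IH as [M HM]; [intros; apply H; now right|].
  destruct (H a (or_introl eq_refl)) as [M' HM'].
  exists (M + M')%nat. intros x [<-|hx]; [apply Hm with M'|apply Hm with M]; auto; lia.
Qed.

(* The bound [eta] keeps the inequality strict in the limit [M -> oo]. *)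
Definition underloaded {d : nat} (free : nat -> bool) (E : nat -> list (nat * Zd d)) (n : nat) (P : Zd d) : Prop :=
  exists eta, eta < mass d free n /\ forall M, load free n P (E M) <= eta.

(** By averaging: otherwise each child has, at some stage, load above its mass minus [eps], and
    monotonicity gives one stage [M] for all of them. Summed over the [K] children this exceeds
    [mass d free n - K * eps], which lies halfway between [eta] and the mass of [P], whereas the
    load of [P] is at most [eta]. *)
Lemma underloaded_child {d : nat} free (E : nat -> list (nat * Zd d)) n (P : Zd d) :
  (forall M M' n P, (M <= M')%nat -> load free n P (E M) <= load free n P (E M')) ->
  underloaded free E n P -> exists P', In P' (children free n P) /\ underloaded free E (S n) P'.
Proof.
  intros Hmon [eta [h1 h2]].
  destruct (classic (exists P', In P' (children free n P) /\ underloaded free E (S n) P')) as [|Hno]; auto.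
  exfalso.
  set (K := INR (length (children free n P))).
  assert (hK : 0 < K).
  { pose proof (children_mass free n P). pose proof (mass_pos d free n). pose proof (mass_pos d free (S n)).
    fold K in H. destruct (Rle_or_lt K 0); auto. nra. }
  set (eps := (mass d free n - eta) / (2 * K)).
  assert (heps : 0 < eps) by (apply Rdiv_lt_0_compat; lra).
  destruct (exists_common_bound (fun P' M => mass d free (S n) - eps < load free (S n) P' (E M)) (children free n P)) as [M HM].
  - intros P' M M' hM H. specialize (Hmon M M' (S n) P' hM). lra.
  - intros P' hP'. apply NNPP. intros Hn. apply Hno. exists P'. split; auto.
    exists (mass d free (S n) - eps). split; [lra|]. intros M. apply Rnot_lt_le. intros h. apply Hn; eauto.
  - assert (h3 := load_children free n P (E M)).
    assert (h4 : K * (mass d free (S n) - eps) <= lsum (fun P' => load free (S n) P' (E M)) (children free n P)).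
    { unfold K. rewrite <- lsum_const. apply lsum_le. intros P' hP'. left. now apply HM. }
    specialize (h2 M). pose proof (children_mass free n P) as h5. fold K in h5.
    assert (h6 : K * eps = (mass d free n - eta) / 2) by (unfold eps; field; lra). nra.
Qed.

(** The address [P] is quantified explicitly because the cubes are closed: a point on a common face
    can have several addresses, and one of them must obey the digit rule. *)
Definition cantor_set {d : nat} (free : nat -> bool) (m0 : nat) (P0 : Zd d) (x : Rd d) : Prop :=
  exists P : nat -> Zd d, P m0 = P0 /\
    (forall n, (m0 <= n)%nat -> In (P (S n)) (children free n (P n))) /\
    forall n m, (m0 <= n)%nat -> 0 <= 2 ^ n * x m - IZR (P n m) <= 1.

(** The intervals [[u n, u n + 2^(-n)]] are nested, and the supremum of their left ends lies in all
    of them. *)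
Lemma nested_dyadic_point (m0 : nat) (z : nat -> Z) :
  (forall n, (m0 <= n)%nat -> (z (S n) = 2 * z n \/ z (S n) = 2 * z n + 1)%Z) ->
  exists x, forall n, (m0 <= n)%nat -> 0 <= 2 ^ n * x - IZR (z n) <= 1.
Proof.
  intros Hz. set (u := fun n => IZR (z n) / 2 ^ n).
  assert (Hstep : forall n, (m0 <= n)%nat -> u n <= u (S n) /\ u (S n) + / 2 ^ (S n) <= u n + / 2 ^ n).
  { intros n hn. unfold u. simpl. assert (0 < 2 ^ n) by (apply pow_lt; lra).
    assert (h : 0 <= IZR (z (S n)) - 2 * IZR (z n) <= 1).
    { rewrite <- mult_IZR, <- minus_IZR. split; apply IZR_le; destruct (Hz n hn); lia. }
    assert (h' : 0 < / 2 ^ n) by now apply Rinv_0_lt_compat.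
    replace (IZR (z (S n)) / (2 * 2 ^ n)) with (IZR (z (S n)) / 2 * / 2 ^ n) by (field; lra).
    replace (/ (2 * 2 ^ n)) with (1 / 2 * / 2 ^ n) by (field; lra). unfold Rdiv at 1 4. split; nra. }
  assert (Hk : forall n k, (m0 <= n)%nat -> u n <= u (n + k)%nat /\ u (n + k)%nat + / 2 ^ (n + k) <= u n + / 2 ^ n).
  { intros n k hn. induction k; [rewrite Nat.add_0_r; lra|].
    rewrite Nat.add_succ_r. destruct (Hstep (n + k)%nat); [lia|]. lra. }
  assert (hpos : forall n, 0 < / 2 ^ n) by (intros; apply Rinv_0_lt_compat, pow_lt; lra).
  assert (Hub : forall n n', (m0 <= n)%nat -> (m0 <= n')%nat -> u n' <= u n + / 2 ^ n).
  { intros n n' hn hn'. destruct (Nat.le_ge_cases n n') as [h|h].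
    - replace n' with (n + (n' - n))%nat by lia. pose proof (Hk n (n' - n)%nat hn).
      pose proof (hpos (n + (n' - n))%nat). lra.
    - pose proof (Hk n' (n - n')%nat hn'). replace (n' + (n - n'))%nat with n in H by lia. pose proof (hpos n). lra. }
  destruct (completeness (fun y => exists n, (m0 <= n)%nat /\ y = u n)) as [x [Hx1 Hx2]].
  - exists (u m0 + / 2 ^ m0). intros y [n [hn ->]]. now apply Hub.
  - exists (u m0), m0. auto.
  - exists x. intros n hn. assert (h1 : u n <= x) by (apply Hx1; eauto).
    assert (h2 : x <= u n + / 2 ^ n) by (apply Hx2; intros y [n' [hn' ->]]; now apply Hub).
    assert (h3 : 0 < 2 ^ n) by (apply pow_lt; lra).
    assert (h4 : 2 ^ n * u n = IZR (z n)) by (unfold u; field; lra).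
    assert (h5 : 2 ^ n * / 2 ^ n = 1) by (field; lra). nra.
Qed.

Lemma cantor_set_of_choice {d : nat} free m0 (P0 : Zd d) (Inv : nat -> Zd d -> Prop) :
  Inv m0 P0 ->
  (forall n P, (m0 <= n)%nat -> Inv n P -> exists P', In P' (children free n P) /\ Inv (S n) P') ->
  exists (x : Rd d) (P : nat -> Zd d), P m0 = P0 /\
    (forall n, (m0 <= n)%nat -> In (P (S n)) (children free n (P n)) /\ Inv n (P n)) /\
    forall n m, (m0 <= n)%nat -> 0 <= 2 ^ n * x m - IZR (P n m) <= 1.
Proof.
  intros H0 Hs.
  destruct (choice (fun (nP : nat * Zd d) P' => (m0 <= fst nP)%nat -> Inv (fst nP) (snd nP) ->
    In P' (children free (fst nP) (snd nP)) /\ Inv (S (fst nP)) P')) as [g Hg].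
  { intros [n P]. destruct (classic ((m0 <= n)%nat /\ Inv n P)) as [[h1 h2]|h].
    - destruct (Hs n P h1 h2) as [P' H']. exists P'; auto.
    - exists P. simpl. tauto. }
  set (Q := fix Q k := match k with O => P0 | S k' => g ((m0 + k')%nat, Q k') end).
  assert (HQ : forall k, Inv (m0 + k)%nat (Q k)).
  { induction k; [now rewrite Nat.add_0_r|]. rewrite Nat.add_succ_r. apply (Hg ((m0 + k)%nat, Q k)); simpl; auto; lia. }
  set (P := fun n => Q (n - m0)%nat).
  assert (HP : forall n, (m0 <= n)%nat -> In (P (S n)) (children free n (P n)) /\ Inv n (P n)).
  { intros n hn. unfold P. replace (S n - m0)%nat with (S (n - m0)) by lia. specialize (HQ (n - m0)%nat).
    replace (m0 + (n - m0))%nat with n in HQ by lia. split; auto. simpl.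
    replace (m0 + (n - m0))%nat with n by lia. now apply (Hg (n, Q (n - m0)%nat)). }
  assert (Hx : forall m, exists x, forall n, (m0 <= n)%nat -> 0 <= 2 ^ n * x - IZR (P n m) <= 1).
  { intros m. apply nested_dyadic_point. intros n hn. apply (in_children free n). now apply HP. }
  destruct (choice _ Hx) as [x Hx']. exists x, P. split; [|split; auto].
  unfold P. now rewrite Nat.sub_diag.
Qed.

Lemma cantor_set_inhabited {d : nat} free m0 (P0 : Zd d) : exists x, cantor_set free m0 P0 x.
Proof.
  destruct (cantor_set_of_choice free m0 P0 (fun _ _ => True)) as [x [P [h1 [h2 h3]]]]; auto.
  - intros n P _ _. unfold children. destruct (free n); [|exists (child P (fun _ => 0%Z)); split; [now left|auto]].
    exists (child P (fun _ => 0%Z)). split; auto. apply in_map. apply in_list_funs. intros; now left.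
  - exists x, P. split; [|split]; auto. intros n hn. now apply h2.
Qed.

(** The mass distribution principle. A set of diameter [2^(-l)] meets at most [7 ^ d] cubes of scale
    [l]; listing these for all [F k] leaves [P0] underloaded, and a branch of underloaded cubes
    leads to [x]. If [F k] contained [x], the cube of the branch at level [lev k] would be listed,
    and its load would reach its mass. *)
Lemma cantor_set_not_covered_levels {d : nat} free m0 (P0 : Zd d) (F : nat -> Rd d -> Prop) (lev : nat -> nat) eta :
  (forall k x y, F k x -> F k y -> forall m, Rabs (x m - y m) <= / 2 ^ (lev k)) ->
  (forall n, sum_f_R0 (fun k => mass d free (lev k)) n <= eta) ->
  INR (7 ^ d) * eta < mass d free m0 ->
  (forall k, (m0 <= lev k)%nat) ->
  exists x, cantor_set free m0 P0 x /\ forall k, ~ F k x.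
Proof.
  intros HF Heta Hlt Hlev.
  assert (Hcyl : forall k, exists C : list (Zd d), (length C <= 7 ^ d)%nat /\
    forall Q y, F k y -> (forall m, 0 <= 2 ^ (lev k) * y m - IZR (Q m) <= 1) -> In Q C).
  { intros k. destruct (classic (exists y, F k y)) as [[y0 hy0]|hno].
    (* The corner of a closed cube meeting [F k] differs from [up (2 ^ lev k * y0)] by an integer
       between [-3] and [1] in each coordinate, hence the box of radius 3 and its [7 ^ d] points. *)
    - exists (map (fun (b : Zd d) m => (b m + up (2 ^ (lev k) * y0 m))%Z) (box d 3)). split.
      + rewrite length_map, box_length. simpl. lia.
      + intros Q y hy hQ. apply in_map_iff.
        exists (fun m => (Q m - up (2 ^ (lev k) * y0 m))%Z). split; [extensionality m; lia|].
        apply in_box. intros m. specialize (HF k y y0 hy hy0 m). specialize (hQ m).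
        destruct (archimed (2 ^ lev k * y0 m)) as [a1 a2]. apply Rabs_le_inv in HF.
        set (U := up (2 ^ lev k * y0 m)) in *.
        assert (hl : 0 < 2 ^ lev k) by (apply pow_lt; lra).
        assert (e1 : 2 ^ lev k * / 2 ^ lev k = 1) by (field; lra).
        assert (b1 : 2 ^ lev k * (y m - y0 m) <= 1) by (rewrite <- e1; apply Rmult_le_compat_l; lra).
        assert (b2 : - 1 <= 2 ^ lev k * (y m - y0 m)).
        { replace (-1) with (2 ^ lev k * - / 2 ^ lev k) by lra. apply Rmult_le_compat_l; lra. }
        assert (c1 : IZR (Q m) - IZR U <= 1) by lra.
        assert (c2 : - 3 <= IZR (Q m) - IZR U) by lra.
        rewrite <- minus_IZR in c1, c2. apply le_IZR in c1, c2. lia.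
    - exists nil. split; [simpl; lia|]. intros Q y hy. elim hno; eauto. }
  destruct (choice _ Hcyl) as [C HC].
  set (E := fun M => flat_map (fun k => map (pair (lev k)) (C k)) (seq 0 (S M))).
  assert (Hmon : forall M M' n P, (M <= M')%nat -> load free n P (E M) <= load free n P (E M')).
  { intros M M' n P hM. unfold load, E. replace (S M') with (S M + (M' - M))%nat by lia.
    rewrite seq_app, flat_map_app, lsum_app.
    set (rest := flat_map _ (seq (0 + S M) _)).
    pose proof (lsum_nonneg (cylinder_weight free n P) rest (cylinder_weight_nonneg free n P)). lra. }
  destruct (cantor_set_of_choice free m0 P0 (underloaded free E)) as [x [P [h1 [h2 h3]]]].
  - exists (INR (7 ^ d) * eta). split; auto. intros M. unfold load, E. rewrite lsum_flat_map.
    apply Rle_trans with (INR (7 ^ d) * sum_f_R0 (fun k => mass d free (lev k)) M).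
    + rewrite sum_f_R0_lsum, <- lsum_scal. apply lsum_le. intros k _. rewrite lsum_map.
      apply Rle_trans with (lsum (fun _ : Zd d => mass d free (lev k)) (C k)).
      * apply lsum_le. intros Q _. apply (cylinder_weight_le free m0 P0 (lev k, Q)).
      * rewrite lsum_const. apply Rmult_le_compat_r; [left; apply mass_pos|]. apply le_INR, HC.
    + apply Rmult_le_compat_l; auto. apply pos_INR.
  - intros n P _ HP. now apply underloaded_child.
  - exists x. split.
    + exists P. split; [|split]; auto. intros n hn. now apply h2.
    + intros k Hk. destruct (h2 (lev k) (Hlev k)) as [_ [eta' [g1 g2]]].
      specialize (g2 k). assert (hin : In (lev k, P (lev k)) (E k)).
      { apply in_flat_map. exists k. split; [apply in_seq; lia|]. apply in_map.
        apply (proj2 (HC k)) with x; auto. }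
      pose proof (load_ge_of_in free _ _ _ hin). lra.
Qed.

Lemma exists_dyadic_level (m0 : nat) (r : R) : 0 < r <= / 2 ^ m0 ->
  exists l, (m0 <= l)%nat /\ r <= / 2 ^ l /\ / 2 ^ (S l) < r.
Proof.
  intros hr.
  assert (H : forall n, r <= / 2 ^ (m0 + n) \/ exists l, (m0 <= l)%nat /\ r <= / 2 ^ l /\ / 2 ^ (S l) < r).
  { induction n; [rewrite Nat.add_0_r; left; lra|]. destruct IHn as [h|h]; auto.
    destruct (Rle_or_lt r (/ 2 ^ (S (m0 + n)))) as [h'|h'].
    - left. now rewrite Nat.add_succ_r.
    - right. exists (m0 + n)%nat. repeat split; auto; lia. }
  destruct (pow2_small 1 (r / 2)) as [n Hn]; [lra..|].
  destruct (H n) as [h|h]; auto. exfalso.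
  specialize (Hn (m0 + n)%nat ltac:(lia)).
  replace (- (1) * INR (m0 + n)) with (- INR (m0 + n)) in Hn by ring. rewrite pow2_opp_INR in Hn. lra.
Qed.

(** Rounding a positive [r] up to a power of two costs the factor [2^t]. A radius [0] has no scale
    of its own; a generation of mass at most [e] is taken instead, and [e] is charged to the
    budget. *)
Lemma exists_light_level (d : nat) free m0 C t r e : 0 < C -> 0 < t -> 0 < e -> 0 <= r <= / 2 ^ m0 ->
  (forall n, mass d free n <= C * Rpower 2 (- t * INR n)) ->
  exists l, (m0 <= l)%nat /\ r <= / 2 ^ l /\ mass d free l <= C * Rpower 2 t * rpow r t + e.
Proof.
  intros hC ht he hr HC. destruct (Rle_lt_or_eq_dec 0 r (proj1 hr)) as [h|h].
  - destruct (exists_dyadic_level m0 r) as [l [h1 [h2 h3]]]; [lra|]. exists l. repeat split; auto.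
    apply Rle_trans with (1 := HC l).
    assert (h4 : Rpower 2 (- t * INR l) <= Rpower 2 t * rpow r t).
    { rewrite <- pow2_opp_INR in h3. replace (- t * INR l) with (t + - INR (S l) * t) by (rewrite S_INR; ring).
      rewrite pow2_plus, <- rpow_pow2. apply Rmult_le_compat_l; [left; apply pow2_pos|].
      apply rpow_le; auto. split; [left; apply pow2_pos|lra]. }
    apply (Rmult_le_compat_l C) in h4; lra.
  - destruct (pow2_small t (e / C)) as [n0 Hn0]; auto; [now apply Rdiv_lt_0_compat|].
    exists (m0 + n0)%nat. split; [lia|]. rewrite <- h. split; [left; apply Rinv_0_lt_compat, pow_lt; lra|].
    rewrite rpow_0, Rmult_0_r, Rplus_0_l. apply Rle_trans with (1 := HC _).
    specialize (Hn0 (m0 + n0)%nat ltac:(lia)). apply (Rmult_le_compat_l C) in Hn0; [|lra].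
    replace (C * (e / C)) with e in Hn0 by (field; lra). auto.
Qed.

(* The dimensions [t a] may approach the dimension of the Cantor set, which is why the
   masses of the cylinders and not the powers [r ^ t a] are added up. *)
Lemma cantor_set_not_covered {d : nat} free m0 (P0 : Zd d) (E : nat -> Rd d -> Prop) (t : nat -> R) :
  (forall a, 0 < t a /\ haus_null (t a) (E a) /\
     exists C, 0 < C /\ forall n, mass d free n <= C * Rpower 2 (- t a * INR n)) ->
  exists x, cantor_set free m0 P0 x /\ forall a, ~ E a x.
Proof.
  intros H.
  assert (h7 : 0 < INR (7 ^ d)). { apply lt_0_INR. apply Nat.neq_0_lt_0. now apply Nat.pow_nonzero. }
  set (eta := mass d free m0 / (2 * INR (7 ^ d))).
  assert (heta : 0 < eta). { apply Rdiv_lt_0_compat; [apply mass_pos|lra]. }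
  assert (hpos : forall n, 0 < / 2 ^ n) by (intros; apply Rinv_0_lt_compat, pow_lt; lra).
  assert (Ha : forall a, exists Fl : (nat -> Rd d -> Prop) * (nat -> nat),
    (forall k, (m0 <= snd Fl k)%nat) /\
    (forall k x y, fst Fl k x -> fst Fl k y -> forall m, Rabs (x m - y m) <= / 2 ^ (snd Fl k)) /\
    (forall x, E a x -> exists k, fst Fl k x) /\
    (forall n, lsum (fun k => mass d free (snd Fl k)) (seq 0 n) <= eta * / 2 ^ (S a))).
  { intros a. destruct (H a) as [ht [Hn [C [hC HC]]]].
    (* The share of [E a] in the total [eta]. One half pays for the powers of the radii, the other
       half for the extra terms of [exists_light_level], in geometric progression over the cover. *)
    set (e := eta * / 2 ^ (S a)). assert (he : 0 < e) by (apply Rmult_lt_0_compat; auto).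
    assert (hCt : 0 < C * Rpower 2 (t a)) by (apply Rmult_lt_0_compat; auto; apply pow2_pos).
    destruct (Hn (/ 2 ^ m0) (hpos m0) (e / 2 / (C * Rpower 2 (t a)))) as [F [r [h1 [h2 h3]]]].
    { apply Rdiv_lt_0_compat; lra. }
    assert (Hl : forall k, exists l, (m0 <= l)%nat /\ r k <= / 2 ^ l /\
       mass d free l <= C * Rpower 2 (t a) * rpow (r k) (t a) + e / 2 * / 2 ^ (S k)).
    { intros k. apply exists_light_level; auto; [|apply h1]. apply Rmult_lt_0_compat; auto; lra. }
    destruct (choice _ Hl) as [l Hl']. exists (F, l). simpl. split; [|split; [|split]].
    - intros k; apply Hl'.
    - intros k x y hx hy m. destruct (h1 k) as [_ h1']. specialize (h1' x y hx hy m).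
      destruct (Hl' k) as [_ [h4 _]]. lra.
    - auto.
    - intros n.
      apply Rle_trans with (lsum (fun k => C * Rpower 2 (t a) * rpow (r k) (t a) + e / 2 * / 2 ^ (S k)) (seq 0 n)).
      + apply lsum_le. intros k _. apply Hl'.
      + rewrite lsum_plus, !lsum_scal. pose proof (lsum_geometric n).
        assert (h5 : lsum (fun k => rpow (r k) (t a)) (seq 0 n) <= e / 2 / (C * Rpower 2 (t a))).
        { destruct n as [|n]; [|rewrite <- sum_f_R0_lsum; apply h3].
          simpl. left. apply Rdiv_lt_0_compat; lra. }
        apply (Rmult_le_compat_l (C * Rpower 2 (t a))) in h5; [|lra].
        replace (C * Rpower 2 (t a) * (e / 2 / (C * Rpower 2 (t a)))) with (e / 2) in h5.
        2: { field. pose proof (pow2_pos (t a)). split; lra. }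
        change (2 * 2 ^ a) with (2 ^ S a). fold e. nra. }
  destruct (choice _ Ha) as [G HG].
  destruct (cantor_set_not_covered_levels free m0 P0
    (fun k => fst (G (fst (Cantor.of_nat k))) (snd (Cantor.of_nat k)))
    (fun k => snd (G (fst (Cantor.of_nat k))) (snd (Cantor.of_nat k))) eta) as [x [hx hF]].
  - intros k. apply HG.
  - apply (lsum_pairing_le (fun a b => mass d free (snd (G a) b))).
    + intros; left; apply mass_pos.
    + intros n. apply Rle_trans with (lsum (fun a => eta * / 2 ^ (S a)) (seq 0 n)).
      * apply lsum_le. intros a _. apply HG.
      * rewrite lsum_scal. pose proof (lsum_geometric n). nra.
  - unfold eta. replace (INR (7 ^ d) * (mass d free m0 / (2 * INR (7 ^ d)))) with (mass d free m0 / 2) by (field; lra).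
    pose proof (mass_pos d free m0). lra.
  - intros k. apply HG.
  - exists x. split; auto. intros a Hax. destruct (HG a) as [_ [_ [h _]]]. destruct (h x Hax) as [b Hb].
    apply (hF (Cantor.to_nat (a, b))). now rewrite Cantor.cancel_of_to.
Qed.

Lemma exists_nat_ceil (x : R) : 0 <= x -> exists c : nat, x <= INR c <= x + 1.
Proof.
  intros hx. destruct (archimed x) as [h1 h2]. exists (Z.to_nat (up x)).
  rewrite INR_IZR_INZ, Z2Nat.id by (apply le_IZR; lra). lra.
Qed.

Lemma cnt_mono free n n' : (n <= n')%nat -> (cnt free n <= cnt free n')%nat.
Proof. induction 1; simpl; lia. Qed.

Lemma cnt_free_run free u k : (forall n, (u <= n < u + k)%nat -> free n = true) ->
  cnt free (u + k) = (cnt free u + k)%nat.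
Proof.
  induction k; intros H; [now rewrite !Nat.add_0_r|].
  rewrite Nat.add_succ_r. simpl. rewrite IHk by (intros; apply H; lia). rewrite H by lia. lia.
Qed.

(* Runs [a, J] of forced digits, with [a ~ theta J], at scales [J] growing so fast that each run
   dwarfs its predecessors: the proportion of free digits then stays above [theta - o(1)]. *)
Lemma lacunary_digits (theta : R) (m0 : nat) (G : nat -> Prop) :
  0 <= theta <= 1 -> (forall n, exists J, (n <= J)%nat /\ G J) ->
  exists free : nat -> bool,
    (forall tau, 0 <= tau < theta -> exists D, forall n, tau * INR n - D <= INR (cnt free n)) /\
    (forall n0, exists J a, (n0 <= J)%nat /\ G J /\ (m0 <= a <= J)%nat /\
       INR a <= theta * INR J + INR m0 + 1 /\ forall n, (a <= n <= J)%nat -> free n = false).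
Proof.
  intros hth HG. destruct (choice _ HG) as [nxt Hnxt].
  destruct (choice (fun (J : nat) c => theta * INR J <= INR c <= theta * INR J + 1)) as [c Hc].
  { intros J. apply exists_nat_ceil. pose proof (pos_INR J). nra. }
  (* The growth [(i + 1) * (Js i + 1) <= Js (i + 1)] makes all digits up to the end of run [i] a
     vanishing proportion of the next scale. *)
  set (Js := fix Js i := match i with O => nxt m0 | S i' => nxt (S i' * S (Js i'))%nat end).
  assert (HJ : forall i, (S i * S (Js i) <= Js (S i))%nat) by (intros i; apply Hnxt).
  assert (HJG : forall i, G (Js i)) by (intros [|i]; apply Hnxt).
  assert (HJ0 : (m0 <= Js 0)%nat) by apply Hnxt.
  assert (HJlt : forall i, (Js i < Js (S i))%nat) by (intros i; specialize (HJ i); nia).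
  assert (HJmon : forall i i', (i <= i')%nat -> (Js i <= Js i')%nat).
  { induction 1; auto. specialize (HJlt m). lia. }
  assert (HJge : forall i, (i <= Js i)%nat).
  { induction i; [lia|]. specialize (HJlt i). lia. }
  (* The shift by [m0] starts the run no earlier than generation [m0]; the minimum intervenes when
     [theta] is so close to 1 that the shifted start would pass [Js i]. *)
  set (a := fun i => Nat.min (Js i) (c (Js i) + m0)).
  set (forced := fun n => exists i, (a i <= n <= Js i)%nat).
  set (free := fun n => if excluded_middle_informative (forced n) then false else true).
  assert (Hfree : forall n, ~ forced n -> free n = true).
  { intros n h. unfold free. destruct (excluded_middle_informative _); easy. }
  exists free. split.
  - intros tau htau.
    destruct (exists_nat_ge (/ (theta - tau))) as [i0 Hi0].
    assert (Hi0' : 1 <= (theta - tau) * INR i0).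
    { apply (Rmult_le_compat_l (theta - tau)) in Hi0; [|lra]. rewrite Rinv_r in Hi0; lra. }
    assert (hdw : forall i, (i0 <= i)%nat -> INR (S (Js i)) <= (theta - tau) * INR (Js (S i))).
    { intros i hi. specialize (HJ i). apply le_INR in HJ. rewrite mult_INR in HJ.
      assert (INR i0 <= INR (S i)) by (apply le_INR; lia). pose proof (pos_INR (S (Js i))).
      assert (h1 : 1 <= (theta - tau) * INR (S i)) by nra.
      apply Rle_trans with ((theta - tau) * (INR (S i) * INR (S (Js i)))); [nra|].
      apply Rmult_le_compat_l; lra. }
    assert (ha : forall i, theta * INR (Js i) <= INR (a i)).
    { intros i. unfold a. pose proof (pos_INR (Js i)). destruct (Nat.min_dec (Js i) (c (Js i) + m0)) as [->| ->]; [nra|].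
      rewrite plus_INR. specialize (Hc (Js i)). pose proof (pos_INR m0). lra. }
    assert (haJ : forall i, (a i <= Js i)%nat) by (intros i; apply Nat.le_min_l).
    assert (hsep : forall i, (i0 <= i)%nat -> (S (Js i) <= a (S i))%nat).
    { intros i hi. apply INR_le. specialize (hdw i hi). specialize (ha (S i)). pose proof (pos_INR (Js (S i))). nra. }
    assert (hrun : forall i k, (i0 <= i)%nat -> (S (Js i) + k <= a (S i))%nat ->
       cnt free (S (Js i) + k) = (cnt free (S (Js i)) + k)%nat).
    { intros i k hi hk. apply cnt_free_run. intros n hn. apply Hfree. intros [i' hi'].
      destruct (Nat.le_gt_cases i' i) as [h|h].
      - pose proof (HJmon i' i h). lia.
      - destruct (Nat.eq_dec i' (S i)) as [->|hne]; [lia|].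
        destruct i' as [|i'']; [lia|]. pose proof (hsep i'' ltac:(lia)).
        pose proof (HJmon (S i) i'' ltac:(lia)). specialize (haJ (S i)). lia. }
    set (D := INR (S (Js i0)) + 1). exists D.
    (* Three positions of [n]. Up to [Js i + 1] the induction applies. In the gap before run [i + 1]
       all digits are free, and the count grows by one at each step, at least as fast as [tau * n].
       Inside that run the count is at least the length of the gap, which with [J = Js (S i)] is at
       least [theta * J - (theta - tau) * J = tau * J]. *)
    assert (Hmain : forall k n, (n <= S (Js (i0 + k)))%nat -> tau * INR n - D <= INR (cnt free n)).
    { induction k; intros n hn.
      - rewrite Nat.add_0_r in hn. apply le_INR in hn. unfold D. pose proof (pos_INR n).
        pose proof (pos_INR (cnt free n)). nra.
      - rewrite Nat.add_succ_r in hn. set (i := (i0 + k)%nat) in *.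
        destruct (Nat.le_gt_cases n (S (Js i))) as [h|h]; auto.
        assert (hi : (i0 <= i)%nat) by (unfold i; lia).
        destruct (Nat.le_gt_cases n (a (S i))) as [h'|h'].
        + specialize (IHk (S (Js i)) (le_n _)). pose proof (hrun i (n - S (Js i))%nat hi) as E.
          replace (S (Js i) + (n - S (Js i)))%nat with n in E by lia. rewrite E by lia.
          rewrite plus_INR, minus_INR by lia. assert (INR (S (Js i)) <= INR n) by (apply le_INR; lia).
          nra.
        + pose proof (hrun i (a (S i) - S (Js i))%nat hi) as E. specialize (hsep i hi).
          replace (S (Js i) + (a (S i) - S (Js i)))%nat with (a (S i)) in E by lia.
          assert (E1 : (a (S i) - S (Js i) <= cnt free n)%nat).
          { apply Nat.le_trans with (cnt free (a (S i))); [rewrite E; lia|]. apply cnt_mono; lia. }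
          apply le_INR in E1. rewrite minus_INR in E1 by lia.
          specialize (hdw i hi). specialize (ha (S i)). apply le_INR in hn. rewrite (S_INR (Js (S i))) in hn.
          assert (1 <= D). { unfold D. pose proof (pos_INR (S (Js i0))). lra. } nra. }
    intros n. apply (Hmain n). specialize (HJge (i0 + n)%nat). lia.
  - intros n0. exists (Js n0), (a n0). repeat split.
    + apply HJge.
    + apply HJG.
    + unfold a. pose proof (HJmon 0%nat n0 ltac:(lia)). lia.
    + apply Nat.le_min_l.
    + apply Rle_trans with (INR (c (Js n0) + m0)); [apply le_INR, Nat.le_min_r|].
      rewrite plus_INR. specialize (Hc (Js n0)). lra.
    + intros n hn. unfold free. destruct (excluded_middle_informative _) as [|h]; auto.
      elim h. exists n0. exact hn.
Qed.

(** * Saturating sequences *)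

(* [k 2^(-j)] is within [rad 2^(-j)] of a dyadic point [K 2^(-a)] of size at most [j]. *)
Definition near_dyadic {d : nat} (rad a j : nat) (k : Zd d) : Prop :=
  exists K : Zd d, (forall m, Z.abs (K m) <= Z.of_nat (j * 2 ^ a))%Z /\
    forall m, (Z.abs (k m - 2 ^ Z.of_nat (j - a) * K m) <= Z.of_nat rad)%Z.

Lemma near_dyadic_list {d : nat} (rad a j : nat) :
  exists l : list (Zd d), (forall k, near_dyadic rad a j k -> In k l) /\
    (length l <= ((2 * j + 1) * 2 ^ a * (2 * rad + 1)) ^ d)%nat.
Proof.
  exists (map (fun KB m => (2 ^ Z.of_nat (j - a) * fst KB m + snd KB m)%Z)
    (list_prod (box d (j * 2 ^ a)) (box d rad))). split.
  - intros k [K [h1 h2]]. apply in_map_iff.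
    exists (K, fun m => (k m - 2 ^ Z.of_nat (j - a) * K m)%Z). split.
    + extensionality m. simpl. lia.
    + apply in_prod; now apply in_box.
  - rewrite length_map, length_prod, !box_length, <- Nat.pow_mul_l. apply Nat.pow_le_mono_l.
    apply Nat.mul_le_mono_r. pose proof (Nat.pow_nonzero 2 a). nia.
Qed.

(** Used with [h = d/p - s] and [dr = d/p]: the exponent then falls from [(d/p - s) j] at [a = 0] to
    [- s j] at [a = j]. *)
Definition saturation (kap h dr : R) (j a : nat) : R :=
  Rpower (1 + INR j) (- kap) * Rpower 2 (h * INR j - dr * INR a).

Lemma saturation_pos kap h dr j a : 0 < saturation kap h dr j a.
Proof. apply Rmult_lt_0_compat; apply exp_pos. Qed.

(* The size of a coefficient is dictated by the lowest scale [a] at which [k 2^(-j)] is dyadic. *)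
Definition saturating {d : nat} (rad : nat) (kap h dr : R) (B : nat -> Zd d -> R) : Prop :=
  (forall j k a, (a <= j)%nat -> near_dyadic rad a j k -> saturation kap h dr j a <= B j k) /\
  (forall j k, B j k = 0 \/
    exists a, (a <= j)%nat /\ near_dyadic rad a j k /\ B j k = saturation kap h dr j a).

Lemma saturating_nonneg {d : nat} rad kap h dr (B : nat -> Zd d -> R) :
  saturating rad kap h dr B -> forall j k, 0 <= B j k.
Proof.
  intros [_ H] j k. destruct (H j k) as [->|[a [_ [_ ->]]]]; [lra|]. left; apply saturation_pos.
Qed.

(** The smallest admissible [a] is taken. As [dr >= 0], [saturation] does not increase with [a], so
    this value dominates those of all other admissible scales. *)
Lemma exists_saturating (d rad : nat) (kap h dr : R) : 0 <= dr ->
  exists B : nat -> Zd d -> R, saturating rad kap h dr B.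
Proof.
  intros hdr.
  destruct (choice (fun (jk : nat * Zd d) v =>
    (forall a, (a <= fst jk)%nat -> near_dyadic rad a (fst jk) (snd jk) -> saturation kap h dr (fst jk) a <= v) /\
    (v = 0 \/ exists a, (a <= fst jk)%nat /\ near_dyadic rad a (fst jk) (snd jk) /\ v = saturation kap h dr (fst jk) a)))
    as [B HB].
  { intros [j k]. simpl.
    set (P := fun a => (a <= j)%nat /\ near_dyadic rad a j k).
    destruct (classic (exists a, P a)) as [Hex|Hno].
    - destruct (Wf_nat.dec_inh_nat_subset_has_unique_least_element P (fun a => classic (P a)) Hex) as [a [[[h1 h2] h3] _]].
      exists (saturation kap h dr j a). split; [|right; eauto].
      intros a' h1' h2'. specialize (h3 a' (conj h1' h2')). apply le_INR in h3.
      apply Rmult_le_compat_l; [left; apply exp_pos|]. apply pow2_le. nra.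
    - exists 0. split; auto. intros a h1 h2. elim Hno. exists a; split; auto. }
  exists (fun j k => B (j, k)). split; intros j k; apply (HB (j, k)).
Qed.

Definition inv_exponent (p : option R) : R := match p with Some r => / r | None => 0 end.

Lemma Rpower_opp_le_1 (x y : R) : 1 <= x -> 0 <= y -> Rpower x (- y) <= 1.
Proof.
  intros hx hy. rewrite <- (Rpower_O x) by lra. apply Rle_Rpower; lra.
Qed.

(** At most a constant times [(1 + j)^d 2^(d a)] positions are near a dyadic point of scale [a], and
    each contributes at most a constant times [(1 + j)^(- kap r) 2^(- d a)]. The powers of two
    cancel, and the sum over the [j + 1] scales [a] gives one more factor [1 + j]. *)
Lemma saturating_layer_sum {N d : nat} (c : cseq N d) rad kap s r (B : nat -> Zd d -> R) C :
  0 < r -> 0 < C -> saturating rad kap (INR d / r - s) (INR d / r) B ->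
  (forall i j k, Cmod (c i j k) <= C * B j k) ->
  exists K, 0 < K /\ forall j l, NoDup l ->
    lsum (fun ik => rpow (Cmod (c (fst ik) j (snd ik)) * Rpower 2 ((s - INR d / r) * INR j)) r) l
      <= K * Rpower (1 + INR j) (INR d + 1 - kap * r).
Proof.
  intros hr hC HB Hc.
  set (K0 := INR ((2 * (2 * rad + 1)) ^ d)).
  exists (rpow C r * K0 * (INR N + 1)).
  assert (hCr : 0 < rpow C r) by now apply rpow_gt_0.
  assert (hK0 : 0 < K0). { apply lt_0_INR, Nat.neq_0_lt_0, Nat.pow_nonzero. lia. }
  split. { repeat apply Rmult_lt_0_compat; auto. pose proof (pos_INR N); lra. }
  intros j l Hl.
  set (f := fun ik : Fin.t N * Zd d => rpow (Cmod (c (fst ik) j (snd ik)) * Rpower 2 ((s - INR d / r) * INR j)) r).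
  assert (hj := pos_INR j).
  set (v := fun a : nat => rpow C r * Rpower (1 + INR j) (- (kap * r)) * Rpower 2 (- (INR d * INR a))).
  assert (hv : forall a, 0 < v a). { intros a. unfold v. repeat apply Rmult_lt_0_compat; auto; apply exp_pos. }
  set (g := fun a (ik : Fin.t N * Zd d) => if excluded_middle_informative (near_dyadic rad a j (snd ik)) then v a else 0).
  assert (hg : forall a ik, 0 <= g a ik).
  { intros a ik. unfold g. destruct (excluded_middle_informative _); [left; apply hv|lra]. }
  assert (Hfg : forall ik, f ik <= lsum (fun a => g a ik) (seq 0 (S j))).
  { intros [i k]. unfold f. simpl fst; simpl snd. destruct HB as [_ HB].
    pose proof (Cmod_nonneg (c i j k)) as hc. specialize (Hc i j k).
    destruct (HB j k) as [E|[a [h1 [h2 E]]]]; rewrite E in Hc.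
    - replace (Cmod (c i j k)) with 0 by lra. rewrite Rmult_0_l, rpow_0. apply lsum_nonneg. intros a; apply hg.
    - apply Rle_trans with (lsum (fun a => g a (i, k)) (a :: nil)).
      + simpl. rewrite Rplus_0_r. unfold g. simpl. destruct (excluded_middle_informative _); [|contradiction].
        apply Rle_trans with (rpow (C * Rpower (1 + INR j) (- kap) * Rpower 2 (- (INR d / r * INR a))) r).
        * apply rpow_le; auto. split; [apply Rmult_le_pos; auto; left; apply pow2_pos|].
          apply Rle_trans with (C * saturation kap (INR d / r - s) (INR d / r) j a * Rpower 2 ((s - INR d / r) * INR j)).
          -- apply Rmult_le_compat_r; auto. left; apply pow2_pos.
          -- right. unfold saturation. rewrite !Rmult_assoc. do 2 f_equal. rewrite <- pow2_plus. f_equal. ring.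
        * right. unfold v. rewrite !rpow_mult.
          -- rewrite rpow_pow2, (rpow_pos (Rpower _ _)), Rpower_mult by apply exp_pos. f_equal; [do 2 f_equal; ring|]. f_equal. field. lra.
          -- lra.
          -- left; apply exp_pos.
          -- apply Rmult_le_pos; [lra|left; apply exp_pos].
          -- left; apply exp_pos.
      + apply lsum_incl; [intros; apply hg|constructor; [easy|constructor]|].
        intros a' [<-|[]] _. apply in_seq. lia. }
  apply Rle_trans with (lsum (fun ik => lsum (fun a => g a ik) (seq 0 (S j))) l).
  { apply lsum_le. intros ik _. apply Hfg. }
  rewrite lsum_swap.
  assert (Hcard : forall a, lsum (fun ik => g a ik) l <= rpow C r * K0 * INR N * Rpower (1 + INR j) (INR d - kap * r)).
  { intros a. destruct (@near_dyadic_list d rad a j) as [nl [h1 h2]].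
    apply Rle_trans with (lsum (g a) (list_prod (fins N) nl)).
    { apply lsum_incl; auto. intros [i k] _. unfold g. simpl. destruct (excluded_middle_informative _); [|lra].
      intros _. apply in_prod; auto. apply in_fins. }
    apply Rle_trans with (lsum (fun _ => v a) (list_prod (fins N) nl)).
    { apply lsum_le. intros ik _. unfold g. destruct (excluded_middle_informative _); [lra|left; apply hv]. }
    rewrite lsum_const, length_prod, fins_length, mult_INR.
    assert (h3 : INR (length nl) <= K0 * Rpower (1 + INR j) (INR d) * Rpower 2 (INR d * INR a)).
    { apply le_INR in h2. apply Rle_trans with (1 := h2).
      unfold K0. rewrite (Rmult_comm (INR d) (INR a)), <- Rpower_mult, !Rpower_pow by (try apply exp_pos; lra).
      rewrite !pow_INR, <- !Rpow_mult_distr. apply pow_incr. split; [apply pos_INR|].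
      rewrite !mult_INR, !plus_INR, !mult_INR, pow_INR. simpl (INR 2). simpl (INR 1).
      replace (1 + 1) with 2 by ring.
      assert (0 < 2 ^ a) by (apply pow_lt; lra). pose proof (pos_INR rad).
      replace (2 * (2 * INR rad + 1) * (1 + INR j) * 2 ^ a) with ((2 * INR j + 2) * 2 ^ a * (2 * INR rad + 1)) by ring.
      apply Rmult_le_compat_r; [lra|]. apply Rmult_le_compat_r; lra. }
    apply Rle_trans with (INR N * (K0 * Rpower (1 + INR j) (INR d) * Rpower 2 (INR d * INR a)) * v a).
    { apply Rmult_le_compat_r; [left; apply hv|]. apply Rmult_le_compat_l; [apply pos_INR|auto]. }
    unfold v, Rminus. rewrite Rpower_plus.
    pose proof (pow2_opp_mult (INR d * INR a)) as h4.
    set (X := Rpower 2 (INR d * INR a)) in *. set (Y := Rpower 2 (- (INR d * INR a))) in *.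
    right. transitivity (rpow C r * K0 * INR N * (Rpower (1 + INR j) (INR d) * Rpower (1 + INR j) (- (kap * r))) * (X * Y)); [ring|].
    rewrite h4. ring. }
  apply Rle_trans with (lsum (fun _ : nat => rpow C r * K0 * INR N * Rpower (1 + INR j) (INR d - kap * r)) (seq 0 (S j))).
  { apply lsum_le. intros a _. apply Hcard. }
  rewrite lsum_const, length_seq, S_INR.
  replace (INR d + 1 - kap * r) with (1 + (INR d - kap * r)) by ring.
  rewrite Rpower_plus, Rpower_1 by lra.
  pose proof (exp_pos ((INR d - kap * r) * ln (1 + INR j))) as hp. fold (Rpower (1 + INR j) (INR d - kap * r)) in hp.
  set (X := Rpower (1 + INR j) (INR d - kap * r)) in *.
  replace ((INR j + 1) * (rpow C r * K0 * INR N * X)) with (INR N * (rpow C r * K0 * ((1 + INR j) * X))) by ring.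
  replace (rpow C r * K0 * (INR N + 1) * ((1 + INR j) * X)) with ((INR N + 1) * (rpow C r * K0 * ((1 + INR j) * X))) by ring.
  apply Rmult_le_compat_r; [|lra]. repeat apply Rmult_le_pos; lra.
Qed.

(** For finite [p] the bound [(1 + j)^(d + 1 - kap p)] on the layer sum becomes [(1 + j)^(- e)]
    after taking the root. For [p = oo] nothing is counted: the size does not depend on [a], and
    [kap = e]. *)
Lemma saturating_layer_norm {N d : nat} (c : cseq N d) rad s p (B : nat -> Zd d -> R) C e :
  (1 <= N)%nat -> ext_pos p -> 0 < C ->
  saturating rad ((INR d + 1) * inv_exponent p + e) (d_over d p - s) (d_over d p) B ->
  (forall i j k, Cmod (c i j k) <= C * B j k) ->
  exists K, 0 < K /\ forall j, exists A, 0 <= A <= K * Rpower (1 + INR j) (- e) /\ layer_norm c p s j A.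
Proof.
  intros hN hp hC HB Hc. destruct p as [r|]; simpl in *.
  - destruct (saturating_layer_sum c rad _ s r B C hp hC HB Hc) as [K [hK HK]].
    exists (rpow K (/ r)). split; [now apply rpow_gt_0|]. intros j.
    destruct (completeness (fun t => exists l : list (Fin.t N * Zd d), NoDup l /\
                  t = lsum (fun ik => rpow (Cmod (c (fst ik) j (snd ik)) *
                                     Rpower 2 ((s - INR d / r) * INR j)) r) l)) as [u Hu].
    + eexists. intros t [l [Hl ->]]. apply HK; auto.
    + exists 0, nil. split; [constructor|reflexivity].
    + exists (rpow u (/ r)). split; [|now exists u].
      split; [apply rpow_nonneg|].
      assert (0 <= u). { apply Hu. exists nil. split; [constructor|reflexivity]. }
      apply Rle_trans with (rpow (K * Rpower (1 + INR j) (INR d + 1 - ((INR d + 1) * / r + e) * r)) (/ r)).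
      * apply rpow_le; [|now apply Rinv_0_lt_compat]. split; auto. apply Hu. intros t [l [Hl ->]]. now apply HK.
      * rewrite rpow_mult by (try lra; left; apply exp_pos). right. f_equal.
        rewrite rpow_pos by apply exp_pos. rewrite Rpower_mult. f_equal. field. lra.
  - exists C. split; auto. intros j.
    assert (Hb : forall i k, Cmod (c i j k) * Rpower 2 (s * INR j) <= C * Rpower (1 + INR j) (- e)).
    { intros i k. pose proof (pow2_pos (s * INR j)) as h1.
      apply Rle_trans with (C * B j k * Rpower 2 (s * INR j)); [apply Rmult_le_compat_r; auto; lra|].
      rewrite Rmult_assoc. apply Rmult_le_compat_l; [lra|]. destruct HB as [_ HB].
      destruct (HB j k) as [->|[a [_ [_ ->]]]].
      - rewrite Rmult_0_l. left; apply exp_pos.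
      - unfold saturation. rewrite Rmult_assoc, <- pow2_plus.
        replace ((0 - s) * INR j - 0 * INR a + s * INR j) with 0 by ring. rewrite pow2_0, Rmult_1_r.
        right. f_equal. ring. }
    destruct (completeness (fun t => exists i k, t = Cmod (c i j k) * Rpower 2 (s * INR j))) as [A HA].
    + exists (C * Rpower (1 + INR j) (- e)). intros t [i [k ->]]. apply Hb.
    + destruct (fin_inhabited N hN) as [i _]. now exists (Cmod (c i j (fun _ => 0%Z)) * Rpower 2 (s * INR j)), i, (fun _ => 0%Z).
    + exists A. split; auto. split.
      * destruct (fin_inhabited N hN) as [i _]. destruct HA as [HA _].
        refine (Rle_trans _ _ _ _ (HA _ (ex_intro _ i (ex_intro _ (fun _ => 0%Z) eq_refl)))).
        apply Rmult_le_pos; [apply Cmod_nonneg|left; apply pow2_pos].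
      * apply HA. intros t [i [k ->]]. apply Hb.
Qed.

Lemma sum_inv_square_le (n : nat) : sum_f_R0 (fun j => Rpower (1 + INR j) (-2)) n <= 2 - / (INR n + 1).
Proof.
  assert (E : forall j, Rpower (1 + INR j) (- 2) = / ((1 + INR j) * (1 + INR j))).
  { intros j. pose proof (pos_INR j). replace (-2) with (Ropp 2) by lra. rewrite Rpower_Ropp. f_equal. replace 2 with (1 + 1) by ring.
    rewrite Rpower_plus, Rpower_1 by lra. reflexivity. }
  induction n.
  - cbn [sum_f_R0]. rewrite E. simpl. lra.
  - rewrite tech5, E, S_INR. pose proof (pos_INR n). set (x := INR n) in *.
    apply Rle_trans with (2 - / (x + 1) + / ((1 + (x + 1)) * (1 + (x + 1)))); [lra|].
    assert (h : / ((1 + (x + 1)) * (1 + (x + 1))) <= / ((x + 1) * (x + 1 + 1))).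
    { apply Rinv_le_contravar; nra. }
    replace (/ ((x + 1) * (x + 1 + 1))) with (/ (x + 1) - / (x + 1 + 1)) in h by (field; lra). lra.
Qed.

(** The choice [e = 2/q] makes the [q]-th powers of the layer norms at most a constant times
    [(1 + j)^(-2)]. *)
Lemma saturating_in_besov {N d : nat} (c : cseq N d) rad s p q (B : nat -> Zd d -> R) C :
  (1 <= N)%nat -> ext_pos p -> ext_pos q -> 0 < C ->
  saturating rad ((INR d + 1) * inv_exponent p + 2 * inv_exponent q) (d_over d p - s) (d_over d p) B ->
  (forall i j k, Cmod (c i j k) <= C * B j k) -> in_besov s p q c.
Proof.
  intros hN hp hq hC HB Hc.
  destruct (saturating_layer_norm c rad s p B C _ hN hp hC HB Hc) as [K [hK HK]].
  destruct (choice _ HK) as [A HA]. exists A. split; [intros; apply HA|].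
  destruct q as [q|]; simpl in *.
  - exists (rpow K q * 2). intros n.
    apply Rle_trans with (rpow K q * sum_f_R0 (fun j => Rpower (1 + INR j) (-2)) n).
    + rewrite scal_sum. apply sum_Rle. intros j _. destruct (HA j) as [h _].
      apply Rle_trans with (rpow (K * Rpower (1 + INR j) (- (2 * / q))) q); [now apply rpow_le|].
      rewrite rpow_mult by (try lra; left; apply exp_pos). rewrite (rpow_pos (Rpower _ _)) by apply exp_pos.
      rewrite Rpower_mult. replace (- (2 * / q) * q) with (-2) by (field; lra). lra.
    + apply Rmult_le_compat_l; [apply rpow_nonneg|]. pose proof (sum_inv_square_le n).
      assert (0 < / (INR n + 1)). { apply Rinv_0_lt_compat. pose proof (pos_INR n). lra. } lra.
  - exists K. intros j. destruct (HA j) as [[_ h] _]. pose proof (Rpower_opp_le_1 (1 + INR j) (2 * 0)).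
    pose proof (pos_INR j). nra.
Qed.

(** * Saturated sequences diverge maximally *)

(** Only bounds are kept of the finite covering family: [L] measures the blocks of layers, and [rad]
    becomes the error allowed in [near_dyadic]. *)
Definition covers_unit_cube {N d : nat} (psi : Fin.t N -> Rd d -> Cx) (c0 : R) (L rad : nat) : Prop :=
  forall x : Rd d, (forall m, 0 <= x m < 1) ->
  exists i j k, (1 <= j <= L)%nat /\ (forall m, Z.abs (k m) <= Z.of_nat rad)%Z /\
    c0 <= Cmod (psi i (dil j k x)).

Lemma dyadic_covering_bounds {N d : nat} (psi : Fin.t N -> Rd d -> Cx) : dyadic_covering psi ->
  exists c0 L rad, 0 < c0 /\ covers_unit_cube psi c0 L rad.
Proof.
  intros [c0 [hc0 [l [Hl Hcov]]]].
  destruct (fin_list_bound (d := 1) l (fun t _ => INR (snd (fst t)))) as [L HL].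
  destruct (fin_list_bound l (fun t m => IZR (Z.abs (snd t m)))) as [rad Hrad].
  exists c0, L, rad. split; auto. intros x hx. destruct (Hcov x hx) as [[[i j] k] [hin H]].
  exists i, j, k. split; [|split].
  - split; [apply (Hl _ hin)|]. apply INR_le. apply (HL _ hin Fin.F1).
  - intros m. apply le_IZR. rewrite <- INR_IZR_INZ. apply (Hrad _ hin).
  - apply Rge_le, H.
Qed.

(** The covering property, rescaled to a dyadic cube of scale [J], uses only wavelets of scales
    [J + 1] to [J + L], so a lower bound on these layers suffices. *)
Definition dominates {N d : nat} (c : cseq N d) (B : nat -> Zd d -> R) (L : nat) (y : R) (J : nat) : Prop :=
  forall i j k, (J < j <= J + L)%nat -> y * B j k <= Cmod (c i j k).

(* The point [x] lies in the dyadic cube of scale [J] whose lower left corner is [K 2^(-a)]. *)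
Definition corner_at {d : nat} (x : Rd d) (J a : nat) (K : Zd d) : Prop :=
  (forall m, 0 <= 2 ^ J * x m - 2 ^ (J - a) * IZR (K m) < 1) /\
  forall m, (Z.abs (K m) <= Z.of_nat (J * 2 ^ a))%Z.

Lemma IZR_pow2 (n : nat) : IZR (2 ^ Z.of_nat n) = 2 ^ n.
Proof. now rewrite <- pow_IZR. Qed.

(** The cube of scale [J] is rescaled to the unit cube and the covering property applied there. A
    wavelet [(j', k')] of the unit cube becomes the wavelet of scale [J + j'] and position
    [2^(j - a) K + k'], which is within [rad] of the multiple of [K] and hence has a large
    coefficient. *)
Lemma large_coefficient_near_corner {N d : nat} (psi : Fin.t N -> Rd d -> Cx) c0 L rad kap h dr
  (B : nat -> Zd d -> R) (c : cseq N d) y x J a K :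
  0 < c0 -> 0 < y -> covers_unit_cube psi c0 L rad -> saturating rad kap h dr B ->
  dominates c B L y J -> (a <= J)%nat -> corner_at x J a K ->
  exists i j k, (J <= j)%nat /\
    y * c0 * saturation kap h dr j a <= Cmod (c i j k) * Cmod (psi i (dil j k x)).
Proof.
  intros hc0 hy Hcov [HB _] Hdom ha [Hx HK].
  destruct (Hcov (fun m => 2 ^ J * x m - 2 ^ (J - a) * IZR (K m)) Hx) as [i [j' [k' [hj' [hk' H]]]]].
  set (j := (J + j')%nat). set (k := fun m => (2 ^ Z.of_nat (j - a) * K m + k' m)%Z).
  exists i, j, k. split; [unfold j; lia|].
  replace (dil j k x) with (dil j' k' (fun m => 2 ^ J * x m - 2 ^ (J - a) * IZR (K m))).
  - assert (hsat : saturation kap h dr j a <= B j k).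
    { apply HB; [unfold j; lia|]. exists K. split.
      - intros m. specialize (HK m). unfold j. nia.
      - intros m. unfold k. replace (2 ^ Z.of_nat (j - a) * K m + k' m - 2 ^ Z.of_nat (j - a) * K m)%Z with (k' m) by ring.
        apply hk'. }
    specialize (Hdom i j k ltac:(unfold j; lia)).
    pose proof (saturation_pos kap h dr j a).
    apply Rle_trans with (y * B j k * c0).
    + assert (0 < y * c0) by now apply Rmult_lt_0_compat. nra.
    + apply Rmult_le_compat; auto; nra.
  - extensionality m. unfold dil, k. rewrite plus_IZR, mult_IZR, IZR_pow2.
    unfold j. replace (J + j' - a)%nat with (j' + (J - a))%nat by lia. rewrite !pow_add. ring.
Qed.

(** From [a <= theta J + D] and [J <= j] the exponent [h j - dr a] is at least
    [(h - dr theta) j - dr D]; the strict gap to [g] absorbs the polynomial factor. *)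
Lemma div_set_of_corners {N d : nat} (psi : Fin.t N -> Rd d -> Cx) c0 L rad kap h dr
  (B : nat -> Zd d -> R) (c : cseq N d) y x theta D :
  0 < c0 -> 0 < y -> 0 <= kap -> 0 <= dr -> 0 <= theta ->
  covers_unit_cube psi c0 L rad -> saturating rad kap h dr B ->
  (forall n0, exists J a K, (n0 <= J)%nat /\ dominates c B L y J /\ (a <= J)%nat /\
     INR a <= theta * INR J + D /\ corner_at x J a K) ->
  forall g, g < h - dr * theta -> div_set psi c x g.
Proof.
  intros hc0 hy hkap hdr hth Hcov HB Hsc g hg.
  set (eps := h - dr * theta - g).
  destruct (pow_absorbed_by_exp kap eps) as [c1 [hc1 Hc1]]; [auto|unfold eps; lra|].
  assert (H : forall n, exists t : Fin.t N * nat * Zd d, (n <= snd (fst t))%nat /\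
    y * c0 * c1 * Rpower 2 (- (dr * D)) * Rpower 2 (g * INR (snd (fst t))) <=
      Cmod (c (fst (fst t)) (snd (fst t)) (snd t)) *
      Cmod (psi (fst (fst t)) (dil (snd (fst t)) (snd t) x))).
  { intros n. destruct (Hsc n) as [J [a [K [h1 [h2 [h3 [h4 h5]]]]]]].
    destruct (large_coefficient_near_corner psi c0 L rad kap h dr B c y x J a K hc0 hy Hcov HB h2 h3 h5)
      as [i [j [k [hj H]]]].
    exists (i, j, k). simpl. split; [lia|]. apply Rle_trans with (2 := H).
    rewrite !(Rmult_assoc (y * c0)). apply Rmult_le_compat_l; [nra|].
    unfold saturation. apply Rle_trans with (c1 * Rpower 2 (- eps * INR j) * Rpower 2 (h * INR j - dr * INR a)).
    - rewrite Rmult_assoc, Rmult_assoc, <- !pow2_plus. apply Rmult_le_compat_l; [lra|]. apply pow2_le.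
      unfold eps. apply le_INR in hj. pose proof (pos_INR J).
      assert (dr * INR a <= dr * (theta * INR j + D)).
      { apply Rmult_le_compat_l; auto. assert (theta * INR J <= theta * INR j) by (apply Rmult_le_compat_l; auto). lra. }
      lra.
    - apply Rmult_le_compat_r; [left; apply pow2_pos|]. apply Hc1. }
  destruct (choice _ H) as [t Ht].
  exists (y * c0 * c1 * Rpower 2 (- (dr * D))). split.
  { repeat apply Rmult_lt_0_compat; auto. apply pow2_pos. }
  exists (fun n => fst (fst (t n))), (fun n => snd (fst (t n))), (fun n => snd (t n)). split.
  - intros M. exists M. intros n hn. destruct (Ht n). lia.
  - intros n. apply Rle_ge, Ht.
Qed.

Lemma corner_bound (x : R) (K : Z) (J a : nat) : Rabs x + 1 <= INR J ->
  Rabs (2 ^ a * x - IZR K) <= 1 -> (Z.abs K <= Z.of_nat (J * 2 ^ a))%Z.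
Proof.
  intros hJ h. apply le_IZR. rewrite abs_IZR, <- INR_IZR_INZ, mult_INR, pow_INR. simpl (INR 2).
  replace (1 + 1) with 2 by ring. pose proof (pow2_ge_1 a).
  apply Rle_trans with (Rabs (2 ^ a * x) + Rabs (- (2 ^ a * x - IZR K))).
  { replace (IZR K) with (2 ^ a * x + - (2 ^ a * x - IZR K)) at 1 by ring. apply Rabs_triang. }
  rewrite Rabs_Ropp.
  rewrite Rabs_mult, (Rabs_pos_eq (2 ^ a)) by lra. pose proof (Rabs_pos x). nra.
Qed.

(** The choice [a = J] is open to every point once [J] exceeds its size; it is the source of the
    universal lower bound [- s]. *)
Lemma floor_corner {d : nat} (x : Rd d) (J : nat) : (forall m, Rabs (x m) + 1 <= INR J) ->
  corner_at x J J (fun m => Int_part (2 ^ J * x m)).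
Proof.
  intros HJ. split; intros m; destruct (base_Int_part (2 ^ J * x m)) as [h1 h2].
  - rewrite Nat.sub_diag. simpl. lra.
  - apply corner_bound with (x m); auto. apply Rabs_le. lra.
Qed.

Lemma cantor_corner {d : nat} free m0 (P0 : Zd d) x P J a :
  P m0 = P0 -> (forall n, (m0 <= n)%nat -> In (P (S n)) (children free n (P n))) ->
  (forall n m, (m0 <= n)%nat -> 0 <= 2 ^ n * x m - IZR (P n m) <= 1) ->
  (m0 <= a <= J)%nat -> (forall n, (a <= n <= J)%nat -> free n = false) ->
  (forall m, Rabs (x m) + 1 <= INR J) -> corner_at x J a (P a).
Proof.
  intros H0 Hs Hx ha Hf HJ. split; intros m.
  - assert (E : forall k, (a + k <= S J)%nat -> P (a + k)%nat m = (2 ^ Z.of_nat k * P a m)%Z).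
    { induction k; intros hk; [rewrite Nat.add_0_r; change (2 ^ Z.of_nat 0)%Z with 1%Z; lia|].
      rewrite Nat.add_succ_r. specialize (Hs (a + k)%nat ltac:(lia)). unfold children in Hs.
      rewrite Hf in Hs by lia. destruct Hs as [<-|[]]. unfold child. rewrite IHk by lia.
      rewrite Nat2Z.inj_succ, Z.pow_succ_r by lia. ring. }
    (* The digit at [J] itself is also forced, so the offset at scale [J + 1] is at most 1 and that
       at scale [J] at most 1/2. This gives the strict bound of the half-open cube although the
       Cantor cubes are closed. *)
    specialize (E (S J - a)%nat ltac:(lia)). replace (a + (S J - a))%nat with (S J) in E by lia.
    specialize (Hx (S J) m ltac:(lia)). rewrite E, mult_IZR, IZR_pow2 in Hx.
    replace (S J - a)%nat with (S (J - a)) in Hx by lia. simpl in Hx. lra.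
  - apply corner_bound with (x m); auto. specialize (Hx a m ltac:(lia)). apply Rabs_le. lra.
Qed.

Lemma div_exp_is_intro {N d : nat} (psi : Fin.t N -> Rd d -> Cx) c x v :
  (forall g, g < v -> div_set psi c x g) -> (forall g, v < g -> ~ div_set psi c x g) ->
  div_exp_is psi c x v.
Proof.
  intros H1 H2. split.
  - intros g Hg. destruct (Rle_or_lt g v) as [|h]; auto. now elim (H2 g h).
  - intros b Hb. destruct (Rle_or_lt v b) as [|h]; auto.
    specialize (Hb _ (H1 ((v + b) / 2) ltac:(lra))). lra.
Qed.

Lemma div_set_below_exp {N d : nat} (psi : Fin.t N -> Rd d -> Cx) c x v g :
  div_exp_is psi c x v -> g < v -> div_set psi c x g.
Proof.
  intros [_ H] hg. apply NNPP. intros Hn.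
  assert (v <= g); [|lra]. apply H. intros g' Hg'. destruct (Rle_or_lt g' g) as [|h]; auto.
  elim Hn. apply div_set_mono with g'; auto. lra.
Qed.

Lemma div_exp_exists {N d : nat} (psi : Fin.t N -> Rd d -> Cx) c x lo hi :
  (forall g, g < lo -> div_set psi c x g) -> (forall g, div_set psi c x g -> g <= hi) ->
  exists v, div_exp_is psi c x v /\ lo <= v <= hi.
Proof.
  intros H1 H2. destruct (completeness (div_set psi c x)) as [v Hv].
  - exists hi. exact H2.
  - exists (lo - 1). apply H1. lra.
  - exists v. split; auto. split.
    + destruct (Rle_or_lt lo v) as [|h]; auto. destruct Hv as [Hv _].
      specialize (Hv _ (H1 ((lo + v) / 2) ltac:(lra))). lra.
    + now apply Hv.
Qed.

Lemma exists_inv_S_le (eps : R) : 0 < eps -> exists n : nat, / (INR n + 1) <= eps.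
Proof.
  intros he. destruct (exists_nat_ge (/ eps)) as [n Hn]. exists n.
  rewrite <- (Rinv_inv eps). apply Rinv_le_contravar; [now apply Rinv_0_lt_compat|lra].
Qed.

Lemma haus_null_empty {d : nat} t : haus_null t (fun _ : Rd d => False).
Proof.
  intros delta hd eps he. exists (fun _ _ => False), (fun _ => 0). repeat split; try easy; try lra.
  intros n. rewrite sum_f_R0_lsum, lsum_const, rpow_0. lra.
Qed.

Lemma mass_le_of_cnt (d : nat) free tau D : (forall n, tau * INR n - D <= INR (cnt free n)) ->
  exists C, 0 < C /\ forall n, mass d free n <= C * Rpower 2 (- (INR d * tau) * INR n).
Proof.
  intros H. exists (Rpower 2 (INR d * D)). split; [apply pow2_pos|]. intros n.
  unfold mass. rewrite <- pow2_opp_INR, <- pow2_plus. apply pow2_le. rewrite mult_INR.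
  specialize (H n). apply (Rmult_le_compat_l (INR d)) in H; [|apply pos_INR]. lra.
Qed.

Lemma cantor_set_in_open {d : nat} (A : Rd d -> Prop) x0 : is_open A -> A x0 ->
  exists m0 (P0 : Zd d), forall free x, cantor_set free m0 P0 x -> A x.
Proof.
  intros HA hx0. destruct (HA x0 hx0) as [e [he Hball]].
  destruct (pow2_small 1 (e / 2)) as [m0 Hm0]; [lra..|].
  exists m0, (fun m => Int_part (2 ^ m0 * x0 m)). intros free x [P [h1 [_ h3]]].
  apply Hball. intros m. specialize (h3 m0 m (le_n _)). rewrite h1 in h3.
  destruct (base_Int_part (2 ^ m0 * x0 m)) as [b1 b2].
  specialize (Hm0 m0 (le_n _)). replace (- (1) * INR m0) with (- INR m0) in Hm0 by ring.
  rewrite pow2_opp_INR in Hm0. assert (hp : 0 < 2 ^ m0) by (apply pow_lt; lra).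
  assert (E : 2 ^ m0 * / 2 ^ m0 = 1) by (field; lra).
  assert (h4 : Rabs (x m - x0 m) <= / 2 ^ m0); [|lra].
  apply Rabs_le. split; apply Rmult_le_reg_l with (2 ^ m0); lra.
Qed.

(** What the divergence argument needs of a sequence. Domination is asked only on blocks that recur
    infinitely often, with a constant [y] depending on the sequence, so that nonzero images of
    [transplant] qualify. *)
Definition saturated {N d : nat} (psi : Fin.t N -> Rd d -> Cx) (s : R) (p q : option R) (c : cseq N d) : Prop :=
  in_besov s p q c /\
  exists c0 L rad kap B y, 0 < c0 /\ 0 < y /\ 0 <= kap /\ covers_unit_cube psi c0 L rad /\
    saturating rad kap (d_over d p - s) (d_over d p) B /\
    forall n, exists J, (n <= J)%nat /\ dominates c B L y J.

Lemma d_over_nonneg (d : nat) p : ext_pos p -> 0 <= d_over d p.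
Proof. destruct p as [r|]; simpl; intros; [apply Rle_mult_inv_pos; auto; apply pos_INR|lra]. Qed.

Lemma saturated_div_set_low {N d : nat} (psi : Fin.t N -> Rd d -> Cx) s p q c : ext_pos p ->
  saturated psi s p q c -> forall x g, g < - s -> div_set psi c x g.
Proof.
  intros hp [_ [c0 [L [rad [kap [B [y [hc0 [hy [hkap [Hcov [HB Hdom]]]]]]]]]]]] x g hg.
  apply (div_set_of_corners psi c0 L rad kap (d_over d p - s) (d_over d p) B c y x 1 0); auto; try lra.
  - now apply d_over_nonneg.
  - intros n0. destruct (fin_bound (fun m => Rabs (x m) + 1)) as [X HX].
    destruct (Hdom (n0 + X)%nat) as [J [hJ HJ]].
    exists J, J, (fun m => Int_part (2 ^ J * x m)). repeat split; try (lia || lra); auto; apply floor_corner;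
    intros m'; apply Rle_trans with (1 := HX m'); apply le_INR; lia.
Qed.

Lemma saturated_exponent {N d : nat} (psi : Fin.t N -> Rd d -> Cx) s p q c : (1 <= N)%nat ->
  (forall i, bounded_fn (psi i)) -> ext_pos p -> ext_pos q -> saturated psi s p q c ->
  forall x, exists v, div_exp_is psi c x v /\ - s <= v <= d_over d p - s.
Proof.
  intros hN hb hp hq Hc x. apply div_exp_exists.
  - now apply saturated_div_set_low with p q.
  - destruct Hc as [Hc _]. destruct (besov_coef_bound s p q c hN hp hq Hc) as [M [_ HM]].
    apply (div_set_le psi c _ M hb HM).
Qed.

(* Points of the Cantor set have exponent at least [g]; the set where it is larger is too
   small to exhaust what is left of the Cantor set once [E] has been removed. *)
Lemma saturated_level_set_avoids {N d : nat} (psi : Fin.t N -> Rd d -> Cx) s r q c :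
  (1 <= d)%nat -> (1 <= N)%nat -> (forall i, bounded_fn (psi i)) -> (forall i, fast_decay (psi i)) ->
  0 < r -> ext_pos q -> saturated psi s (Some r) q c ->
  forall A x0 g, is_open A -> A x0 -> - s <= g <= INR d / r - s ->
  forall t E, (0 < t < INR d - s * r - g * r /\ haus_null t E) \/
              (INR d - s * r - g * r = 0 /\ forall x, ~ E x) ->
  exists x, A x /\ div_exp_is psi c x g /\ ~ E x.
Proof.
  intros hd hN hb hdec hr hq Hc A x0 g HA hx0 hg t E HE.
  set (beta := INR d - s * r - g * r) in *.
  assert (hdpos : 0 < INR d) by (apply lt_0_INR; lia).
  assert (hbeta : 0 <= beta <= INR d).
  { unfold beta. destruct hg as [g1 g2]. apply (Rmult_le_compat_r r) in g1, g2; try lra.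
    replace ((INR d / r - s) * r) with (INR d - s * r) in g2 by (field; lra). lra. }
  set (theta := beta / INR d).
  assert (hth : 0 <= theta <= 1).
  { unfold theta. split; [apply Rle_mult_inv_pos; lra|]. apply Rmult_le_reg_r with (INR d); auto.
    replace (beta / INR d * INR d) with beta by (field; lra). lra. }
  assert (hgth : (INR d / r - s) - INR d / r * theta = g).
  { unfold theta, beta. field. lra. }
  destruct Hc as [Hbes [c0 [L [rad [kap [B [y [hc0 [hy [hkap [Hcov [HB Hdom]]]]]]]]]]]].
  destruct (cantor_set_in_open A x0 HA hx0) as [m0 [P0 HP0]].
  destruct (lacunary_digits theta m0 (dominates c B L y) hth Hdom) as [free [Hcnt Hrun]].
  assert (Hlow : forall x, cantor_set free m0 P0 x -> forall g', g' < g -> div_set psi c x g').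
  { intros x [P [h1 [h2 h3]]] g' hg'.
    apply (div_set_of_corners psi c0 L rad kap (INR d / r - s) (INR d / r) B c y x theta (INR m0 + 1)); auto; try lra.
    - intros n0. destruct (fin_bound (fun m => Rabs (x m) + 1)) as [X HX].
      destruct (Hrun (n0 + X)%nat) as [J [a [b1 [b2 [b3 [b4 b5]]]]]].
      assert (corner_at x J a (P a)).
      { apply (cantor_corner free m0 P0); auto. intros m'; apply Rle_trans with (1 := HX m'); apply le_INR; lia. }
      exists J, a, (P a). repeat split; try lia; try lra; auto; apply H. }
  destruct HE as [[ht HE]|[hb0 HE]].
  (* Index [0] holds the set to be avoided; the others hold the points of exponent at least about
     [g + 1/(n' + 1)], of dimension at most [beta - r/(n' + 1)]. The exponent [tn] lies strictly
     between that value and [beta], and the maximum with [beta / 2] keeps it positive. *)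
  - set (tn := fun n => match n with O => t | S n' => Rmax (beta - r / (2 * (INR n' + 1))) (beta / 2) end).
    set (En := fun n => match n with O => E | S n' => fun x => div_set psi c x (g + / (INR n' + 1)) end).
    destruct (cantor_set_not_covered free m0 P0 En tn) as [x [hx Hx]].
    + intros n.
      assert (htn : 0 < tn n < beta).
      { destruct n as [|n']; simpl; auto. pose proof (pos_INR n').
        assert (0 < r / (2 * (INR n' + 1))) by (apply Rdiv_lt_0_compat; lra). split.
        - apply Rlt_le_trans with (beta / 2); [lra|apply Rmax_r].
        - apply Rmax_lub_lt; lra. }
      split; [lra|]. split.
      * destruct n as [|n']; simpl in *; auto. pose proof (pos_INR n').
        apply (div_set_haus_null psi s r q c); auto; try lra.
        apply Rlt_le_trans with (2 := Rmax_l _ _).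
        replace (INR d - s * r - (g + / (INR n' + 1)) * r) with (beta - 2 * (r / (2 * (INR n' + 1)))).
        2: { unfold beta. field. lra. }
        assert (0 < r / (2 * (INR n' + 1))) by (apply Rdiv_lt_0_compat; lra). lra.
      * destruct (Hcnt (tn n / INR d)) as [D HD].
        { split; [apply Rle_mult_inv_pos; lra|]. unfold theta. apply Rmult_lt_compat_r; [now apply Rinv_0_lt_compat|lra]. }
        destruct (mass_le_of_cnt d free _ D HD) as [C [hC HC]]. exists C. split; auto.
        intros n0. specialize (HC n0). replace (INR d * (tn n / INR d)) with (tn n) in HC by (field; lra). auto.
    + exists x. split; [now apply (HP0 free)|]. split; [|apply (Hx 0%nat)].
      apply div_exp_is_intro; [now apply Hlow|].
      intros g' hg' Hg'. destruct (exists_inv_S_le (g' - g)) as [n hn]; [lra|].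
      apply (Hx (S n)). simpl. apply div_set_mono with g'; auto. lra.
  (* If [beta = 0], then [g] is the largest possible exponent [d/r - s]; the coefficient bound
     controls the exponent from above at every point, and any point of the Cantor set will do. *)
  - destruct (cantor_set_inhabited free m0 P0) as [x hx]. exists x.
    split; [now apply (HP0 free)|]. split; auto. apply div_exp_is_intro; [now apply Hlow|].
    intros g' hg' Hg'. destruct (besov_coef_bound s (Some r) q c hN hr hq Hbes) as [M [_ HM]].
    apply (div_set_le psi c _ M hb HM) in Hg'. simpl in Hg'.
    assert (g = INR d / r - s); [|lra]. unfold beta in hb0. apply Rmult_eq_reg_r with r; [|lra].
    replace ((INR d / r - s) * r) with (INR d - s * r) by (field; lra). lra.
Qed.

Lemma saturated_max_divergent {N d : nat} (psi : Fin.t N -> Rd d -> Cx) s p q c :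
  (1 <= d)%nat -> (1 <= N)%nat -> (forall i, bounded_fn (psi i)) -> (forall i, fast_decay (psi i)) ->
  ext_pos p -> ext_pos q -> saturated psi s p q c ->
  max_divergent psi s p c (fun _ => True).
Proof.
  intros hd hN hb hdec hp hq Hc.
  assert (Hexp := saturated_exponent psi s p q c hN hb hp hq Hc).
  destruct p as [r|]; simpl in *.
  2: { intros x _. destruct (Hexp x) as [v [Hv hv]]. replace (- s) with v by lra. exact Hv. }
  assert (Hnull := div_set_haus_null psi s r q c hN hb hdec hq hp (proj1 Hc)).
  assert (hdpos : 0 < INR d) by (apply lt_0_INR; lia).
  split; [|split].
  - auto.
  - apply leb_null_of_haus_null; auto.
    (* An exponent other than [- s] exceeds it by more than some [1/(n + 1)], and each of these
       countably many sets has dimension at most [d - r/(n + 1)]. *)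
    apply (haus_null_mono _ _ (fun x => exists n, div_set psi c x (- s + / (INR n + 1)))).
    + intros x [_ Hx]. destruct (Hexp x) as [v [Hv hv]].
      destruct (Rle_lt_or_eq_dec (- s) v (proj1 hv)) as [h|h]; [|now subst v].
      destruct (exists_inv_S_le ((v + s) / 2)) as [n Hn]; [lra|].
      exists n. apply (div_set_below_exp psi c x v); auto. lra.
    + apply haus_null_union. intros n. apply Hnull; auto. pose proof (pos_INR n).
      assert (0 < / (INR n + 1)) by (apply Rinv_0_lt_compat; lra). nra.
  - intros A HA [x0 hx0] _ g hg.
    assert (Hav := saturated_level_set_avoids psi s r q c hd hN hb hdec hp hq Hc A x0 g HA hx0 hg).
    assert (hbeta : 0 <= INR d - s * r - g * r).
    { destruct hg as [_ g2]. apply (Rmult_le_compat_r r) in g2; try lra.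
      replace ((INR d / r - s) * r) with (INR d - s * r) in g2 by (field; lra). lra. }
    set (beta := INR d - s * r - g * r) in *.
    split; [|split].
    + destruct (Hav (beta / 2) (fun _ => False)) as [x [h1 [h2 _]]]; eauto.
      destruct (Rle_lt_or_eq_dec 0 beta hbeta) as [h|h].
      * left. split; [lra|apply haus_null_empty].
      * right. split; auto.
    + intros t ht Ht. destruct (Rle_or_lt beta t) as [|h]; auto. exfalso.
      (* The level set itself is taken as the set to avoid, which yields a point of it outside
         it. *)
      destruct (Hav t _ (or_introl (conj (conj ht h) Ht))) as [x [h1 [h2 h3]]]. auto.
    + intros w Hw. destruct (Rle_or_lt w beta) as [|h]; auto. exfalso.
      set (t := (w + beta) / 2).
      assert (w <= t); [|unfold t in *; lra]. apply Hw; [unfold t; lra|].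
      set (g' := g - (t - beta) / (2 * r)).
      assert (hpos : 0 < (t - beta) / (2 * r)) by (apply Rdiv_lt_0_compat; unfold t; lra).
      apply (haus_null_mono _ _ (fun x => div_set psi c x g')).
      * intros x [_ Hx]. apply (div_set_below_exp psi c x g); auto. unfold g'; lra.
      * apply Hnull; [unfold t; lra|].
        replace (INR d - s * r - g' * r) with (beta + (t - beta) / 2) by (unfold g', beta; field; lra).
        unfold t; lra.
Qed.

(** * Linear combinations and Hamel bases *)

Definition C1 : Cx := mkC 1 0.
Definition Copp (a : Cx) : Cx := mkC (- Cre a) (- Cim a).
Definition Cinv (a : Cx) : Cx :=
  mkC (Cre a / (Cre a * Cre a + Cim a * Cim a)) (- Cim a / (Cre a * Cre a + Cim a * Cim a)).

Lemma Cx_ring : ring_theory C0 C1 Cadd Cmul (fun a b => Cadd a (Copp b)) Copp eq.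
Proof.
  constructor; intros; repeat match goal with x : Cx |- _ => destruct x end;
  unfold Cadd, Cmul, Copp, C0, C1; simpl; try reflexivity; f_equal; ring.
Qed.

Add Ring Cx_ring : Cx_ring.

Lemma Cinv_l (a : Cx) : a <> C0 -> Cmul (Cinv a) a = C1.
Proof.
  intros H. destruct a as [x y].
  assert (h : x * x + y * y <> 0).
  { intros h. apply H. unfold C0. f_equal; nra. }
  unfold Cmul, Cinv, C1; simpl. f_equal; field; auto.
Qed.

Lemma Cmul_eq_0 (a b : Cx) : a <> C0 -> Cmul a b = C0 -> b = C0.
Proof.
  intros ha H. transitivity (Cmul (Cmul (Cinv a) a) b).
  - rewrite Cinv_l by auto. ring.
  - transitivity (Cmul (Cinv a) (Cmul a b)); [ring|]. rewrite H. ring.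
Qed.

Definition csum {I : Type} (f : I -> Cx) (l : list I) : Cx :=
  fold_right (fun t acc => Cadd (f t) acc) C0 l.

Lemma csum_app {I : Type} (f : I -> Cx) l1 l2 : csum f (l1 ++ l2) = Cadd (csum f l1) (csum f l2).
Proof. induction l1; simpl; [ring|]. rewrite IHl1. ring. Qed.

Lemma csum_ext {I : Type} (f g : I -> Cx) l : (forall t, In t l -> f t = g t) -> csum f l = csum g l.
Proof.
  induction l; intros H; simpl; auto. rewrite H by now left. rewrite IHl; auto. intros; apply H; now right.
Qed.

Lemma csum_scal {I : Type} z (f : I -> Cx) l : csum (fun t => Cmul z (f t)) l = Cmul z (csum f l).
Proof. induction l; simpl; [ring|]. rewrite IHl. ring. Qed.

Lemma lincomb_at {N d : nat} {I : Type} (l : list I) a (e : I -> cseq N d) i j k :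
  lincomb l a e i j k = csum (fun t => Cmul (a t) (e t i j k)) l.
Proof. induction l; simpl; auto. unfold sadd at 1, sscal at 1. now rewrite IHl. Qed.

Lemma cseq_ext {N d : nat} (u v : cseq N d) : (forall i j k, u i j k = v i j k) -> u = v.
Proof. intros H. extensionality i. extensionality j. extensionality k. apply H. Qed.

Lemma lincomb_map {N d : nat} {I J : Type} (g : J -> I) (l : list J) (a : I -> Cx) (e : I -> cseq N d) :
  lincomb (map g l) a e = lincomb l (fun t => a (g t)) (fun t => e (g t)).
Proof. induction l; simpl; auto. now rewrite IHl. Qed.

Lemma lincomb_ext {N d : nat} {I : Type} (l : list I) a a' (e : I -> cseq N d) :
  (forall t, In t l -> a t = a' t) -> lincomb l a e = lincomb l a' e.
Proof.
  intros H. apply cseq_ext. intros. rewrite !lincomb_at. apply csum_ext. intros t ht. now rewrite H.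
Qed.

(** Coefficients are a function of the index, so an index already in the list cannot receive a
    second coefficient: the two are merged, and [NoDup] ensures that the merged one is counted
    once. *)
Lemma lincomb_insert {N d : nat} {I : Type} (e : I -> cseq N d) l a z t : NoDup l ->
  exists l' a', NoDup l' /\ sadd (sscal z (e t)) (lincomb l a e) = lincomb l' a' e.
Proof.
  intros Hl. destruct (classic (In t l)) as [h|h].
  - destruct (in_split t l h) as [l1 [l2 ->]].
    exists (l1 ++ t :: l2), (fun x => if excluded_middle_informative (x = t) then Cadd z (a t) else a x).
    split; auto. apply cseq_ext. intros i j k. unfold sadd, sscal. rewrite !lincomb_at, !csum_app. simpl.
    destruct (excluded_middle_informative (t = t)) as [_|n]; [|now elim n].
    apply NoDup_remove_2 in Hl.
    assert (E : forall l', incl l' (l1 ++ l2) ->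
      csum (fun x => Cmul (if excluded_middle_informative (x = t) then Cadd z (a t) else a x) (e x i j k)) l'
      = csum (fun x => Cmul (a x) (e x i j k)) l').
    { intros l' Hl'. apply csum_ext. intros x hx. destruct (excluded_middle_informative (x = t)) as [->|]; auto.
      elim Hl. now apply Hl'. }
    rewrite !E; [ring| |]; intros x hx; apply in_app_iff; auto.
  - exists (t :: l), (fun x => if excluded_middle_informative (x = t) then z else a x).
    split; [now constructor|]. simpl. destruct (excluded_middle_informative (t = t)) as [_|n]; [|now elim n].
    f_equal. apply lincomb_ext. intros x hx. destruct (excluded_middle_informative (x = t)) as [->|]; easy.
Qed.

Lemma lincomb_add_NoDup {N d : nat} {I : Type} (e : I -> cseq N d) l1 a1 l2 a2 : NoDup l2 ->
  exists l a, NoDup l /\ sadd (lincomb l1 a1 e) (lincomb l2 a2 e) = lincomb l a e.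
Proof.
  intros Hl2. induction l1 as [|t l1 [l [a [Hl E]]]]; simpl.
  - exists l2, a2. split; auto. apply cseq_ext. intros. unfold sadd, szero. ring.
  - destruct (lincomb_insert e l a (a1 t) t Hl) as [l' [a' [Hl' E']]].
    exists l', a'. split; auto. rewrite <- E', <- E. apply cseq_ext. intros. unfold sadd. ring.
Qed.

Lemma lincomb_add {N d : nat} {I : Type} (e : I -> cseq N d) l1 a1 l2 a2 :
  exists l a, sadd (lincomb l1 a1 e) (lincomb l2 a2 e) = lincomb l a e.
Proof.
  (* Adding the empty combination rewrites the second one without repetitions. *)
  destruct (lincomb_add_NoDup e l2 a2 nil a2 (NoDup_nil _)) as [l3 [a3 [H3 E3]]].
  destruct (lincomb_add_NoDup e l1 a1 l3 a3 H3) as [l [a [_ E]]].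
  exists l, a. rewrite <- E, <- E3. simpl. f_equal. apply cseq_ext. intros. unfold sadd, szero. ring.
Qed.

Lemma lincomb_scal {N d : nat} {I : Type} (e : I -> cseq N d) l a z :
  sscal z (lincomb l a e) = lincomb l (fun t => Cmul z (a t)) e.
Proof.
  apply cseq_ext. intros. unfold sscal. rewrite !lincomb_at, <- csum_scal. apply csum_ext. intros. ring.
Qed.

Definition independent {N d : nat} (S : cseq N d -> Prop) : Prop :=
  forall (l : list (cseq N d)) a, NoDup l -> (forall v, In v l -> S v) ->
    lincomb l a (fun v => v) = szero -> forall v, In v l -> a v = C0.

(** Zorn's lemma for inclusion: a linear relation involves finitely many vectors, and in a chain
    these all lie in one member. *)
Lemma exists_maximal_independent {N d : nat} (X : cseq N d -> Prop) :
  exists S, ((forall v, S v -> X v) /\ independent S) /\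
    forall S', (forall v, S v -> S' v) -> (forall v, S' v -> X v) -> independent S' -> forall v, S' v -> S v.
Proof.
  destruct (@classical_sets.Zorn_bigcup (cseq N d) (fun S => (forall v, S v -> X v) /\ independent S)) as [S [HS Hmax]].
  - intros F HF Htot. split.
    + intros v [S hS hv]. now apply (HF S hS).
    + intros l a Hl Hin E v hv.
      enough (HS : exists S, F S /\ forall v, In v l -> S v).
      { destruct HS as [S [hS HS]]. destruct (HF S hS) as [_ Hi]. now apply (Hi l). }
      assert (Hne : exists S, F S) by (destruct (Hin v hv) as [S hS _]; eauto).
      clear Hl E hv. induction l as [|w l IH]; [destruct Hne as [S hS]; exists S; easy|].
      destruct IH as [S [hS HS]]; [intros; apply Hin; now right|].
      destruct (Hin w (or_introl eq_refl)) as [S' hS' hw].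
      destruct (Htot S S' hS hS') as [h|h].
      * exists S'. split; auto. intros u [<-|hu]; [exact hw|apply h, HS, hu].
      * exists S. split; auto. intros u [<-|hu]; [apply h, hw|apply HS, hu].
  - exists S. split; auto. intros S' h1 h2 h3 v hv. apply NNPP. intros hn.
    apply (Hmax S'); [|split; auto]. split; auto.
Qed.

(** In a relation between [w] and vectors of [S], a nonzero coefficient of [w] can be inverted to
    express [w]. If [w] were not spanned, adjoining it would therefore preserve independence,
    against maximality. *)
Lemma maximal_independent_spans {N d : nat} (X S : cseq N d -> Prop) :
  independent S ->
  (forall S', (forall v, S v -> S' v) -> (forall v, S' v -> X v) -> independent S' -> forall v, S' v -> S v) ->
  (forall v, S v -> X v) ->
  forall w, X w -> exists l a, (forall v, In v l -> S v) /\ w = lincomb l a (fun v => v).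
Proof.
  intros Hi Hmax HX w hw. destruct (classic (S w)) as [h|h].
  - exists (w :: nil), (fun _ => C1). split; [intros v [<-|[]]; auto|].
    apply cseq_ext. intros. rewrite lincomb_at. simpl. ring.
  - set (S' := fun v => S v \/ v = w).
    assert (Hn : ~ independent S').
    { intros Hi'. apply h. apply (Hmax S'); auto.
      - now left.
      - intros v [hv| ->]; auto.
      - now right. }
    apply NNPP. intros Hno. apply Hn. intros l a Hl Hin E.
    destruct (classic (In w l)) as [hwl|hwl].
    + destruct (in_split w l hwl) as [l1 [l2 ->]].
      assert (HinS : forall v, In v (l1 ++ l2) -> S v).
      { intros v hv. destruct (Hin v) as [| ->]; auto.
        - apply in_app_iff in hv. apply in_app_iff. simpl. tauto.
        - apply NoDup_remove_2 in Hl. contradiction. }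
      assert (E' : forall i j k, Cadd (Cmul (a w) (w i j k)) (lincomb (l1 ++ l2) a (fun v => v) i j k) = C0).
      { intros i j k. apply (f_equal (fun u => u i j k)) in E. unfold szero in E. rewrite <- E.
        rewrite !lincomb_at, !csum_app. simpl. ring. }
      destruct (classic (a w = C0)) as [haw|haw].
      * intros v hv. apply in_app_iff in hv. simpl in hv. destruct (classic (v = w)) as [->|hvw]; auto.
        apply (Hi (l1 ++ l2) a); auto.
        -- now apply NoDup_remove_1 in Hl.
        -- apply cseq_ext. intros i j k. specialize (E' i j k). rewrite haw in E'.
           unfold szero. rewrite <- E'. ring.
        -- apply in_app_iff. destruct hv as [|[|]]; auto. now elim hvw.
      * exfalso. apply Hno. exists (l1 ++ l2), (fun v => Cmul (Copp (Cinv (a w))) (a v)). split; auto.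
        rewrite <- lincomb_scal. apply cseq_ext. intros i j k. unfold sscal. specialize (E' i j k).
        set (u := lincomb (l1 ++ l2) a (fun v => v) i j k) in *.
        transitivity (Cmul (Cmul (Cinv (a w)) (a w)) (w i j k)); [rewrite Cinv_l by auto; ring|].
        transitivity (Cadd (Cmul (Cinv (a w)) (Cadd (Cmul (a w) (w i j k)) u)) (Cmul (Copp (Cinv (a w))) u)); [ring|].
        rewrite E'. ring.
    + apply Hi; auto. intros v hv. destruct (Hin v hv) as [| ->]; auto. contradiction.
Qed.

Lemma exists_hamel_basis {N d : nat} (X : cseq N d -> Prop) :
  exists (I : Type) (e : I -> cseq N d), hamel_basis X e.
Proof.
  destruct (exists_maximal_independent X) as [S [[HX Hi] Hmax]].
  exists {v | S v}, (@proj1_sig _ S). split; [|split].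
  - intros [v hv]. now apply HX.
  - intros l a Hl E.
    assert (Hinj : forall x y : {v | S v}, proj1_sig x = proj1_sig y -> x = y).
    { intros [x hx] [y hy]. simpl. intros <-. f_equal. apply Classical_Prop.proof_irrelevance. }
    set (a' := fun v => match excluded_middle_informative (S v) with left h => a (exist _ v h) | right _ => C0 end).
    assert (Ha : forall t, a t = a' (proj1_sig t)).
    { intros t. unfold a'. destruct (excluded_middle_informative _) as [h|h]; [f_equal; now apply Hinj|].
      elim h. apply proj2_sig. }
    intros t ht. rewrite Ha. apply (Hi (map (@proj1_sig _ S) l)).
    + apply FinFun.Injective_map_NoDup; auto.
    + intros v hv. apply in_map_iff in hv. destruct hv as [x [<- _]]. apply proj2_sig.
    + rewrite lincomb_map, <- E. apply lincomb_ext. intros; now rewrite Ha.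
    + now apply in_map.
  - intros w hw. destruct (maximal_independent_spans X S Hi Hmax HX w hw) as [l [a [Hl ->]]].
    assert (H : exists l', l = map (@proj1_sig _ S) l').
    { clear hw. induction l as [|v l IH]; [now exists nil|].
      destruct IH as [l' ->]; [intros; apply Hl; now right|].
      exists (exist _ v (Hl v (or_introl eq_refl)) :: l'). reflexivity. }
    destruct H as [l' ->]. exists l', (fun t => a (proj1_sig t)). exact (lincomb_map (@proj1_sig _ S) l' a (fun v => v)).
Qed.

(** * The transplant map and the lineability theorem *)

Lemma Zd_enumeration (d : nat) : exists f : nat -> Zd d, forall k, exists n, f n = k.
Proof.
  induction d as [|d [f Hf]].
  - exists (fun _ m => Fin.case0 _ m). intros k. exists 0%nat. extensionality m. apply (Fin.case0 (fun _ => _) m).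
  - set (z := fun n => (Z.of_nat (fst (Cantor.of_nat n)) - Z.of_nat (snd (Cantor.of_nat n)))%Z).
    exists (fun n m => Fin.caseS' m (fun _ => Z) (z (fst (Cantor.of_nat n))) (f (snd (Cantor.of_nat n)))).
    intros k. destruct (Hf (fun m => k (Fin.FS m))) as [n2 Hn2].
    exists (Cantor.to_nat (Cantor.to_nat (Z.to_nat (k Fin.F1), Z.to_nat (- k Fin.F1)), n2)).
    rewrite Cantor.cancel_of_to. cbn [fst snd]. rewrite Hn2. unfold z. rewrite Cantor.cancel_of_to. cbn [fst snd].
    replace (Z.of_nat (Z.to_nat (k Fin.F1)) - Z.of_nat (Z.to_nat (- k Fin.F1)))%Z with (k Fin.F1) by lia.
    symmetry. apply Zd_eta.
Qed.

(** The second component of the Cantor code is ignored by [sigma] and serves as a counter, so every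
    index recurs beyond any rank. *)
Lemma recurrent_enumeration (N d : nat) : (1 <= N)%nat ->
  exists sigma : nat -> Fin.t N * nat * Zd d, forall t n0, exists n, (n0 <= n)%nat /\ sigma n = t.
Proof.
  intros hN. destruct (fin_inhabited N hN) as [i0 _]. destruct (Zd_enumeration d) as [f Hf].
  set (tau := fun n => let (a, b) := Cantor.of_nat n in let (b1, b2) := Cantor.of_nat b in
    (nth a (fins N) i0, b1, f b2)).
  exists (fun n => tau (fst (Cantor.of_nat n))). intros [[i j] k] n0.
  destruct (In_nth _ _ i0 (in_fins N i)) as [a [_ Ha]]. destruct (Hf k) as [b2 Hb2].
  exists (Cantor.to_nat (Cantor.to_nat (a, Cantor.to_nat (j, b2)), n0)). split.
  - pose proof (Cantor.to_nat_non_decreasing (Cantor.to_nat (a, Cantor.to_nat (j, b2))) n0). lia.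
  - rewrite Cantor.cancel_of_to. unfold tau. cbn [fst snd]. now rewrite !Cantor.cancel_of_to, Ha, Hb2.
Qed.

(* Block [n] of [L + 1] layers carries a copy of [B], multiplied by the normalised coefficient
   of [u] of index [sigma n]; every coefficient of [u] is thus seen on infinitely many blocks. *)
Definition transplant {N d : nat} (sigma : nat -> Fin.t N * nat * Zd d) (L : nat) (h : R)
  (B : nat -> Zd d -> R) (u : cseq N d) : cseq N d :=
  fun i j k => let t := sigma (j / (L + 1))%nat in
    Cmul (mkC (Rpower 2 (- (h * INR (snd (fst t)))) * B j k) 0) (u (fst (fst t)) (snd (fst t)) (snd t)).

Lemma transplant_lincomb {N d : nat} {I : Type} sigma L h B (l : list I) a (e : I -> cseq N d) :
  transplant sigma L h B (lincomb l a e) = lincomb l a (fun t => transplant sigma L h B (e t)).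
Proof.
  apply cseq_ext. intros i j k. unfold transplant. rewrite !lincomb_at, <- csum_scal.
  apply csum_ext. intros. ring.
Qed.

Lemma transplant_szero {N d : nat} sigma L h B : transplant sigma L h B (@szero N d) = szero.
Proof. apply cseq_ext. intros. unfold transplant, szero. ring. Qed.

Lemma near_dyadic_0 {d : nat} rad j : near_dyadic rad 0 j (fun _ : Fin.t d => 0%Z).
Proof. exists (fun _ => 0%Z). split; intros m; rewrite ?Z.mul_0_r; simpl; lia. Qed.

(** The origin is dyadic of scale [0], so [B] is positive at [k = 0] on every layer; the first layer
    of a block assigned to [(i, j, k)] then reveals [u i j k]. *)
Lemma transplant_injective {N d : nat} sigma L h rad kap h' dr B (u : cseq N d) :
  saturating rad kap h' dr B -> (forall t n0, exists n, (n0 <= n)%nat /\ sigma n = t) ->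
  transplant sigma L h B u = szero -> u = szero.
Proof.
  intros [HB _] Hs E. apply cseq_ext. intros i j k. destruct (Hs (i, j, k) 0%nat) as [n [_ Hn]].
  apply (f_equal (fun v => v i (n * (L + 1))%nat (fun _ => 0%Z))) in E.
  unfold transplant in E. rewrite Nat.div_mul, Hn in E by lia. simpl in E.
  unfold szero. apply Cmul_eq_0 with (2 := E). intros E0. apply (f_equal Cre) in E0. simpl in E0.
  specialize (HB (n * (L + 1))%nat (fun _ => 0%Z) 0%nat ltac:(lia) (near_dyadic_0 _ _)).
  pose proof (saturation_pos kap h' dr (n * (L + 1)) 0). pose proof (pow2_pos (- (h * INR j))). nra.
Qed.

(** The normalisation turns the coefficient bound on [u] into the constant [M], whichever
    coefficient a block carries. *)
Lemma transplant_le {N d : nat} sigma L h B (u : cseq N d) M : (forall j k, 0 <= B j k) ->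
  (forall i j k, Cmod (u i j k) <= M * Rpower 2 (h * INR j)) ->
  forall i j k, Cmod (transplant sigma L h B u i j k) <= M * B j k.
Proof.
  intros HB Hu i j k. unfold transplant. destruct (sigma (j / (L + 1))%nat) as [[i' j'] k']. simpl.
  pose proof (pow2_pos (- (h * INR j'))) as hp. specialize (HB j k). specialize (Hu i' j' k').
  rewrite Cmod_mul, Cmod_real by nra.
  pose proof (pow2_opp_mult (h * INR j')) as E. set (X := Rpower 2 (h * INR j')) in *.
  set (Y := Rpower 2 (- (h * INR j'))) in *.
  apply Rle_trans with (Y * B j k * (M * X)); [apply Rmult_le_compat_l; nra|].
  replace (Y * B j k * (M * X)) with (M * B j k * (X * Y)) by ring. rewrite E. lra.
Qed.

Lemma transplant_dominates {N d : nat} sigma L h B (u : cseq N d) : (forall j k, 0 <= B j k) ->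
  (forall t n0, exists n, (n0 <= n)%nat /\ sigma n = t) -> u <> szero ->
  exists y, 0 < y /\ forall n, exists J, (n <= J)%nat /\ dominates (transplant sigma L h B u) B L y J.
Proof.
  intros HB Hs Hu.
  assert (H : exists i j k, u i j k <> C0).
  { apply NNPP. intros Hno. apply Hu. apply cseq_ext. intros i j k. apply NNPP. intros hne. apply Hno. eauto. }
  destruct H as [i [j [k H]]]. apply Cmod_gt_0 in H.
  pose proof (pow2_pos (- (h * INR j))) as hp.
  exists (Rpower 2 (- (h * INR j)) * Cmod (u i j k)). split; [now apply Rmult_lt_0_compat|].
  (* Blocks of [L + 1] layers put [J + 1, ..., J + L] in the block that starts at
     [J = n * (L + 1)]. *)
  intros n0. destruct (Hs (i, j, k) n0) as [n [hn Hn]]. exists (n * (L + 1))%nat. split; [nia|].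
  intros i' j' k' hj'. unfold transplant.
  replace (j' / (L + 1))%nat with n.
  - rewrite Hn. simpl. specialize (HB j' k'). rewrite Cmod_mul, Cmod_real by nra. right. ring.
  - apply Nat.div_unique with (j' - n * (L + 1))%nat; lia.
Qed.

(** This pointwise bound passes to finite combinations of basis vectors, and through [transplant_le]
    and [saturating_in_besov] it places their images in the Besov space. *)
Lemma lincomb_coef_bound {N d : nat} {I : Type} (l : list I) a (e : I -> cseq N d) (w : nat -> R) :
  (forall j, 0 <= w j) ->
  (forall t, exists M, 0 < M /\ forall i j k, Cmod (e t i j k) <= M * w j) ->
  exists M, 0 < M /\ forall i j k, Cmod (lincomb l a e i j k) <= M * w j.
Proof.
  intros hw He. induction l as [|t l [M [hM HM]]].
  - exists 1. split; [lra|]. intros i j k. simpl. unfold szero. rewrite Cmod_C0. specialize (hw j). lra.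
  - destruct (He t) as [M' [hM' HM']]. pose proof (Cmod_nonneg (a t)) as ha.
    exists (2 * (Cmod (a t) * M' + M)). split; [nra|]. intros i j k. simpl. unfold sadd, sscal.
    apply Rle_trans with (1 := Cmod_add_le _ _). rewrite Cmod_mul.
    specialize (HM i j k). specialize (HM' i j k). apply (Rmult_le_compat_l _ _ _ ha) in HM'. nra.
Qed.

Theorem mainTheorem13 (d N : nat) (hd : (1 <= d)%nat) (hN : (1 <= N)%nat)
  (psi : Fin.t N -> Rd d -> Cx)
  (hbd : forall i, bounded_fn (psi i)) (hdec : forall i, fast_decay (psi i))
  (s : R) (p q : option R) (hp : ext_pos p) (hq : ext_pos q) :
  dyadic_covering psi ->
  maximal_lineable
    (fun c : cseq N d => in_besov s p q c /\ max_divergent psi s p c (fun _ => True))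
    (in_besov s p q).
Proof.
  intros Hcov. destruct (dyadic_covering_bounds psi Hcov) as [c0 [L [rad [hc0 Hc0]]]].
  set (h := d_over d p - s).
  set (kap := (INR d + 1) * inv_exponent p + 2 * inv_exponent q).
  assert (hinv : forall r, ext_pos r -> 0 <= inv_exponent r).
  { intros [r|]; simpl; intros; [left; now apply Rinv_0_lt_compat|lra]. }
  assert (hkap : 0 <= kap).
  { pose proof (hinv p hp). pose proof (hinv q hq). pose proof (pos_INR d). unfold kap. nra. }
  destruct (exists_saturating d rad kap h (d_over d p) (d_over_nonneg d p hp)) as [B HB].
  assert (hB := saturating_nonneg _ _ _ _ B HB).
  destruct (recurrent_enumeration N d hN) as [sigma Hsigma].
  destruct (exists_hamel_basis (@in_besov N d s p q)) as [I [e [He1 [He2 He3]]]].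
  set (T := transplant sigma L h B : cseq N d -> cseq N d).
  assert (Hbd : forall l a, exists M, 0 < M /\ forall i j k,
    Cmod (lincomb l a e i j k) <= M * Rpower 2 (h * INR j)).
  { intros l a. apply (lincomb_coef_bound l a e (fun j => Rpower 2 (h * INR j))).
    - intros; left; apply pow2_pos.
    - intros t. apply (besov_coef_bound s p q); auto. }
  assert (Hbes : forall l a, in_besov s p q (T (lincomb l a e))).
  { intros l a. destruct (Hbd l a) as [M [hM HM]].
    apply (saturating_in_besov _ rad s p q B M); auto. now apply transplant_le. }
  (* The subspace consists of the images of explicit combinations of the basis, each of which comes
     with the coefficient bound [Hbd]. *)
  exists (fun c => exists l a, c = T (lincomb l a e)). split; [split; [|split]|split; [|split]].
  - exists nil, (fun _ => C0). simpl. symmetry. apply transplant_szero.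
  - intros u v [l1 [a1 ->]] [l2 [a2 ->]]. unfold T. rewrite !transplant_lincomb.
    destruct (lincomb_add (fun t => transplant sigma L h B (e t)) l1 a1 l2 a2) as [l [a E]].
    exists l, a. now rewrite E, transplant_lincomb.
  - intros z u [l [a ->]]. exists l, (fun t => Cmul z (a t)). unfold T.
    now rewrite !transplant_lincomb, lincomb_scal.
  - intros c [l [a ->]]. apply Hbes.
  - intros c [l [a ->]]. destruct (classic (lincomb l a e = szero)) as [E|E].
    + right. rewrite E. apply transplant_szero.
    + left. split; [apply Hbes|]. apply saturated_max_divergent with q; auto. split; [apply Hbes|].
      destruct (transplant_dominates sigma L h B _ hB Hsigma E) as [y [hy Hy]].
      exists c0, L, rad, kap, B, y. auto 10.
  (* As [T] is injective, the images of the basis vectors are independent; both bases share one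
     index type, and the identity is the bijection. *)
  - exists I, I, (fun t => T (e t)), e, (fun t => t). split; [|split; [split; auto|]].
    + split; [|split].
      * intros t. exists (t :: nil), (fun _ => C1). f_equal. apply cseq_ext. intros. rewrite lincomb_at. simpl. ring.
      * intros l a Hl E. apply He2; auto. unfold T in E. rewrite <- transplant_lincomb in E.
        now apply (transplant_injective sigma L h rad kap h (d_over d p) B).
      * intros w [l [a ->]]. exists l, a. apply transplant_lincomb.
    + split; [auto|]. intros y. now exists y.
Qed.
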